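(* Let $n\ge 10$ be an integer with a factorization $n=abcr$ into positive integers with $a,b,c$ pairwise relatively prime. Suppose there exist distinct closed points $P_1,\ldots,P_r$ of the weighted projective plane $\mathbb{P}_{\mathbb{C}}(a,b,c)$ with $xyz\notin I_{P_i}$ for $i=1,\ldots,r$, such that there does not exist an $E$-uniform negative curve on the blow up $X$ of $\mathbb{P}_{\mathbb{C}}(a,b,c)$ at $P_1,\ldots,P_r$, where $E=E_1+\cdots+E_r$. Then Nagata's conjecture is true for $n=abcr$ general points in $\mathbb{P}^2_{\mathbb{C}}$; that is, if $q_1,\ldots,q_n$ are independent generic points of $\mathbb{P}^2_{\mathbb{C}}$, then $$[I_{q_1}^m\cap\cdots\cap I_{q_n}^m]_d=0$$ for all positive integers $d,m$ with $d\le\sqrt{n}\,m$.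
   Context: $S=\mathbb{C}[x,y,z]$ is graded by $\mathrm{wt}(x)=a$, $\mathrm{wt}(y)=b$, $\mathrm{wt}(z)=c$, and $\mathbb{P}_{\mathbb{C}}(a,b,c)=\mathrm{proj}(S)$. $I_{P_i}\subset S$ is the weighted homogeneous ideal of $P_i$; the condition $xyz\notin I_{P_i}$ implies that $P_i$ is a nonsingular point. Let $f:X\to\mathbb{P}_{\mathbb{C}}(a,b,c)$ be the blow up of $P_1,\dots,P_r$, with exceptional curves $E_i$ over $P_i$ and $E=E_1+\cdots+E_r$, and let $A$ be a Weil divisor on $X$ with $\mathcal{O}_X(A)\cong f^*\mathcal{O}(1)$. Weil divisors on the normal surface $X$ are intersected using Mumford's $\mathbb{Q}$-valued intersection theory: $(A\cdot A)=\frac{1}{abc}$, $(E_i\cdot E_i)=-1$, $(E_i\cdot E_j)=0$ for $i\ne j$, $(A\cdot E_i)=0$. An $E$-uniform negative curve is an effective divisor $D$ on $X$ such that $D\sim dA-mE$ for some positive integers $d,m$ and $(D\cdot D)<0$. For a point $q\in\mathbb{P}^2_{\mathbb{C}}$, $I_q\subset\mathbb{C}[u,v,w]$ (standard grading) is its homogeneous ideal, and $[J]_d$ is the degree $d$ part of a homogeneous ideal $J$. Points $q_1,\ldots,q_n$ of $\mathbb{P}^2_{\mathbb{C}}$ are independent generic if $q_i=(1:s_i:t_i)$ with $s_1,t_1,\ldots,s_n,t_n$ algebraically independent over $\mathbb{Q}$. *)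

(* Defs.v *)
From HB Require Import structures.
From mathcomp Require Import all_boot all_order all_algebra.
From mathcomp Require Import boolp classical_sets reals.
From mathcomp Require Import complex.
From mathcomp Require Import mpoly freeg.

Set Implicit Arguments.
Unset Strict Implicit.
Unset Printing Implicit Defensive.

Import Order.TTheory GRing.Theory Num.Theory.

Local Open Scope ring_scope.
Local Open Scope classical_set_scope.

Section Ideals.
Variable S : comNzRingType.
Implicit Types (I J : set S) (k : nat).

(* In the library [idealr_closed] includes properness. *)
Definition prime_ideal I : Prop :=
  idealr_closed (mem I) /\ prime_idealr_closed (mem I).

Definition ideal_mul I J : set S :=
  [set f | exists (N : nat) (g h : 'I_N -> S),
     [/\ forall i, I (g i), forall i, J (h i) & f = \sum_i g i * h i]].

Fixpoint ideal_pow I k : set S :=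
  if k is k'.+1 then ideal_mul I (ideal_pow I k') else setT.

(* I^(k) = I^k S_I \cap S, for I prime *)
Definition symbolic_pow I k : set S :=
  [set f | exists2 s, ~ I s & ideal_pow I k (s * f)].

End Ideals.

Section WeightedDegree.
Variables a b c : nat.

Definition wdeg (m : 'X_{1..3}) : nat :=
  (a * m (0%R : 'I_3) + b * m (1%R : 'I_3) + c * m (2%R : 'I_3))%N.

Lemma wdeg0 : wdeg 0%MM = 0%N.
Proof. by rewrite /wdeg !mnm0E !muln0. Qed.

Lemma wdegD : {morph wdeg : m1 m2 / (m1 + m2)%MM >-> (m1 + m2)%N}.
Proof.
by move=> m1 m2; rewrite /wdeg !mnmDE !mulnDr [X in (X + _)%N]addnACA addnACA.
Qed.

HB.instance Definition _ := isMeasure.Build 3 wdeg wdeg0 wdegD.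

End WeightedDegree.

Section WeightedProjectivePlane.
Variables (R : realType) (a b c : nat).

Local Notation S := {mpoly R[i][3]}.

Definition homog_ideal (I : set S) : Prop :=
  forall f, I f -> forall d, I (pihomog (wdeg a b c) d f).

Definition irrelevant_ideal : set S := [set f | pihomog (wdeg a b c) 0 f = 0].

Record proj := Proj {
  proj_ideal :> set S;
  proj_prime : prime_ideal proj_ideal;
  proj_homog : homog_ideal proj_ideal;
  proj_relevant : ~ irrelevant_ideal `<=` proj_ideal
}.

(* The closure of p in proj(S) consists of the q containing p. *)
Definition closed_point (p : proj) : Prop :=
  forall q : proj, p `<=` q -> q = p.

(* [set 0] is the ideal of the generic point. *)
Definition codim1_point (p : proj) : Prop :=
  proj_ideal p <> [set 0] /\
  forall q : proj, q `<=` p -> proj_ideal q <> [set 0] -> q = p.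

Record curve := Curve {
  curve_point :> proj;
  curve_codim1 : codim1_point curve_point
}.

HB.instance Definition _ := gen_eqMixin curve.
HB.instance Definition _ := gen_choiceMixin curve.

End WeightedProjectivePlane.

Section BlowUp.
Variables (R : realType) (a b c r : nat).
Variable P : 'I_r -> proj R a b c.

Local Notation S := {mpoly R[i][3]}.

(* The prime divisors of the blow up X of the nonsingular closed points P i:
   [inl C] is the strict transform of the curve C, and [inr i] is E_i. *)
Definition prime_divisor : Type := (curve R a b c + 'I_r)%type.

Definition weil_divisor : Type := {freeg (curve R a b c + 'I_r)%type / int}.

Definition center (V : prime_divisor) : proj R a b c :=
  match V with inl C => C | inr i => P i end.

(* D is the divisor on X of F, seen as a section of f^*O(e) for e = deg F.
   The local ring of proj(S) at the center p of a prime divisor V is regular,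
   O(1) is invertible there because a, b, c are pairwise coprime and no P i
   lies on xyz = 0, and the order along V (of dimension one at p, or the
   exceptional curve over p) is the m_p-adic order; F has order at least k
   there iff F belongs to the k-th symbolic power of the ideal of p. *)
Definition div_section (F : S) (D : weil_divisor) : Prop :=
  forall V : prime_divisor, exists k : nat,
    [/\ coeff V D = k%:Z, symbolic_pow (center V) k F
      & ~ symbolic_pow (center V) k.+1 F].

(* D is the divisor of a nonzero rational section F/G of f^*O(e),
   i.e. O_X(D) is isomorphic to the reflexive sheaf f^*O(e). *)
Definition div_rational_section (e : int) (D : weil_divisor) : Prop :=
  exists (k l : nat) (F G : S) (DF DG : weil_divisor),
    [/\ [/\ F != 0, F \is k.-homog for (wdeg a b c) & div_section F DF],
        [/\ G != 0, G \is l.-homog for (wdeg a b c) & div_section G DG],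
        k%:Z - l%:Z = e
      & D = DF - DG].

(* The function field of X consists of the fractions of degree 0. *)
Definition lin_equiv (D D' : weil_divisor) : Prop :=
  div_rational_section 0 (D - D').

Definition pullback_O1 (A : weil_divisor) : Prop := div_rational_section 1 A.

Definition exceptional (i : 'I_r) : weil_divisor := << inr i >>.

Definition exceptional_sum : weil_divisor := \sum_i exceptional i.

Definition effective (D : weil_divisor) : Prop := forall V, 0 <= coeff V D.

(* The class group of X is free on A, E_1, ..., E_r, so Mumford's pairing,
   which is bilinear and invariant under linear equivalence, is determined by
   (A.A) = 1/(abc), (A.E_i) = 0 and (E_i.E_j) = - (i == j). *)
Definition intersection_number (A D D' : weil_divisor) (q : rat) : Prop :=
  exists (d d' : int) (m m' : 'I_r -> int),
    [/\ lin_equiv D (A *~ d - \sum_i exceptional i *~ m i),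
        lin_equiv D' (A *~ d' - \sum_i exceptional i *~ m' i)
      & q = (d * d')%:~R / (a * b * c)%:R - (\sum_i m i * m' i)%:~R].

Definition E_uniform_negative_curve (A D : weil_divisor) : Prop :=
  [/\ effective D,
      exists d m : nat,
        [/\ (0 < d)%N, (0 < m)%N & lin_equiv D (A *+ d - exceptional_sum *+ m)]
    & exists2 q : rat, intersection_number A D D q & q < 0].

End BlowUp.

Section GenericPoints.
Variable R : realType.

Definition alg_independent_over_Q k (v : 'I_k -> R[i]) : Prop :=
  forall p : {mpoly rat[k]}, mmap ratr v p = 0 -> p = 0.

(* the points (1 : s_i : t_i) are independent generic *)
Definition independent_generic n (s t : 'I_n -> R[i]) : Prop :=
  alg_independent_over_Q
    (fun j : 'I_(n + n) => match split j with inl i => s i | inr i => t i end).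

(* the homogeneous ideal of the point of P^2 with homogeneous coordinates v *)
Definition point_ideal (v : 'I_3 -> R[i]) : set {mpoly R[i][3]} :=
  [set f | forall d, (pihomog mdeg d f).@[v] = 0].

End GenericPoints.

(* Main.v *)
(* Let f be a nonzero form of degree d with m-fold zeros at the n generic points,
   d^2 <= n m^2.  The existence of such a form is a condition on the rank of a
   matrix over Z[s, t], so it persists for every choice of n points over every
   field.

   If d^2 < n m^2, specialise the points to the preimages of P_1, ..., P_r under
   (x : y : z) |-> (x^a : y^b : z^c).  The group of this covering permutes the
   preimages, so the isotypic components of f also vanish m-fold there; a nonzero
   component is a monomial times F(x^a, y^b, z^c), and F is a form of weighted
   degree e <= d with m-fold zeros at the P_i.  The effective divisor
   div F - m E ~ e A - m E has self-intersection e^2/(abc) - r m^2 < 0.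

   If d^2 = n m^2, then n = k^2 with k >= 4 and d = k m.  Put k points on each of
   k lines, three of which form a triangle with points so chosen that forms with
   m-fold zeros on the three sides never agree at the vertices.  The only form of degree
   k m with m-fold zeros at all the points, or (m-1)-fold at one of them, is then
   the m-th power of the product of the lines.  Moving that one point off its line
   over Q(t), a form f_0 + t f_1 + ... with m-fold zeros would have f_0 and f_1
   both proportional to this power, which contradicts the m-fold vanishing to
   first order in t. *)
Require Import Defs.
From HB Require Import structures.
From mathcomp Require Import all_boot all_order all_algebra.
From mathcomp Require Import cyclic separable cyclotomic.
From mathcomp Require Import boolp classical_sets reals.
From mathcomp Require Import complex.
From mathcomp Require Import mpoly freeg.
From mathcomp Require Import ring zify.

Set Implicit Arguments.
Unset Strict Implicit.
Unset Printing Implicit Defensive.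

Import Order.TTheory GRing.Theory Num.Theory.
Local Open Scope ring_scope.

(** * Graded pieces and orders of vanishing *)

(** Multiplicities are measured at vectors of affine 3-space, by divided derivatives, not in charts
    of the plane. These are integer polynomials in the vector, so they commute with every
    specialisation, and on a form they scale along orbits, so the choice of representative is
    harmless. The divisor side has to be brought to this language. By the Nullstellensatz on the
    slice xyz = 1, a closed point off xyz = 0 is the ideal of an orbit, and a form lies in a
    symbolic power of that ideal according to its multiplicity at a vector of the orbit. A form has
    a divisor only once its order along every curve is known to be finite, and nonzero for finitely
    many curves; unique factorisation gives this by making the ideal of a curve principal. In the
    square case a fourth line is needed because the triangle argument uses the full multiplicities
    on its three sides, so the point to be moved must lie elsewhere; this is where n >= 10
    enters. *)

Lemma rmorph_mmap n (R S T : comNzRingType) (u : {rmorphism S -> T})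
    (f : R -> S) (h : 'I_n -> S) (F : {mpoly R[n]}) :
  u (mmap f h F) = mmap (u \o f) (u \o h) F.
Proof.
rewrite /mmap rmorph_sum; apply: eq_bigr => m _.
rewrite rmorphM rmorph_prod; congr (_ * _).
by apply: eq_bigr => i _; rewrite rmorphXn.
Qed.

Lemma eq_mmap n (R : comNzRingType) (S : nzRingType) (f f' : R -> S)
    (h h' : 'I_n -> S) : f =1 f' -> h =1 h' -> mmap f h =1 mmap f' h'.
Proof.
move=> eqf eqh F; apply: eq_bigr => m _; rewrite eqf; congr (_ * _).
by apply: eq_bigr => i _; rewrite eqh.
Qed.

Lemma rmorph_mpolyP n (R S : comNzRingType)
    (u u' : {rmorphism {mpoly R[n]} -> S}) :
  (forall c, u c%:MP = u' c%:MP) -> (forall i, u 'X_i = u' 'X_i) -> u =1 u'.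
Proof.
move=> eqC eqX F.
have FE : F = mmap (@mpolyC n R) (fun i => 'X_i) F.
  rewrite {1}[F]mpolyE; apply: eq_bigr => m _.
  by rewrite mmap1_id mul_mpolyC.
by rewrite FE !rmorph_mmap; apply: eq_mmap.
Qed.

Section Grade.
Variables (n : nat) (R : comNzRingType) (mf : measure n).

(** This is F with ['X_i] multiplied by the w_i-th power of a new variable. Being a ring morphism,
    it turns questions on components of a product into questions on coefficients of a univariate
    product. *)
Definition grade (F : {mpoly R[n]}) : {poly {mpoly R[n]}} :=
  mmap (polyC \o @mpolyC n R) (fun i => ('X_i)%:P * 'X^(mf U_(i)%MM)) F.

HB.instance Definition _ :=
  GRing.RMorphism.copy grade
    (mmap (polyC \o @mpolyC n R) (fun i => ('X_i)%:P * 'X^(mf U_(i)%MM))).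

Lemma gradeX m : mmap1 (fun i => ('X_i : {mpoly R[n]})%:P * 'X^(mf U_(i)%MM)) m
  = ('X_[m])%:P * 'X^(mf m).
Proof.
rewrite /mmap1 mpolyXE_id rmorph_prod [mf m]mfE.
rewrite (eq_bigr (fun i => ('X_i ^+ m i)%:P * 'X^(m i * mf U_(i)%MM)));
  last by move=> i _; rewrite exprMn rmorphXn -exprM mulnC.
by rewrite big_split /= -expr_sum.
Qed.

Lemma coef_grade F d : (grade F)`_d = pihomog mf d F.
Proof.
rewrite /grade /mmap coef_sum pihomogE [RHS]big_mkcond /=.
apply: eq_bigr => m _; rewrite gradeX mulrA -polyCM mul_mpolyC coefCM coefXn.
by rewrite eq_sym; case: eqP; rewrite ?mulr1 ?mulr0.
Qed.

Lemma grade_homog F d : F \is d.-homog for mf -> grade F = F *: 'X^d.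
Proof.
move=> Fd; apply/polyP => e; rewrite coef_grade coefZ coefXn.
have [->|ne] := eqVneq e d; first by rewrite pihomog_dE // mulr1.
by rewrite (pihomog_ne0 _ Fd) ?mulr0 // eq_sym.
Qed.

Lemma grade_eq0 F : grade F = 0 -> F = 0.
Proof.
move=> F0; rewrite (pihomog_partitionE (leqnn (mmeasure mf F))).
by apply: big1 => i _; rewrite -coef_grade F0 coef0.
Qed.

Lemma pihomog_mull d e (F G : {mpoly R[n]}) : F \is d.-homog for mf ->
  pihomog mf (d + e) (F * G) = F * pihomog mf e G.
Proof.
move=> Fd; rewrite -!coef_grade rmorphM /= (grade_homog Fd).
by rewrite -mul_polyC -mulrA coefCM coefXnM ltnNge leq_addr /= addKn.
Qed.

End Grade.

Lemma poly_low_exists (R : nzRingType) (p : {poly R}) : p != 0 ->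
  exists2 a, (forall i, (i < a)%N -> p`_i = 0) & p`_a != 0.
Proof.
move=> p0; have ex : exists i, p`_i != 0.
  by exists (size p).-1; rewrite -lead_coefE lead_coef_eq0.
exists (ex_minn ex); case: ex_minnP => // a _ amin i ia.
by apply/eqP; apply: contraTT ia => /amin; rewrite -leqNgt.
Qed.

Lemma coef_low_mul (R : nzRingType) (p q : {poly R}) a b :
  (forall i, (i < a)%N -> p`_i = 0) -> (forall i, (i < b)%N -> q`_i = 0) ->
  (forall i, (i < a + b)%N -> (p * q)`_i = 0) /\
  (p * q)`_(a + b) = p`_a * q`_b.
Proof.
move=> pa qb; split => [i iab|].
  rewrite coefM big1 // => j _; have [/pa ->|aj] := ltnP j a.
    by rewrite mul0r.
  by rewrite qb ?mulr0 //; have := ltn_ord j; lia.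
have la : (a < (a + b).+1)%N by rewrite ltnS leq_addr.
rewrite coefM (bigD1 (Ordinal la)) //= addKn big1 ?addr0 // => j.
rewrite -val_eqE /= => ja; have [/pa ->|aj] := ltnP j a.
  by rewrite mul0r.
by rewrite qb ?mulr0 //; have := ltn_ord j; lia.
Qed.

(** The lowest components of F and G multiply to a nonzero component of F * G, so their degrees add
    up to d. The sizes of the graded polynomials add up likewise, so in each factor the lowest and
    the highest degree coincide. *)
Lemma homog_factor n (R : idomainType) (mf : measure n)
    (F G : {mpoly R[n]}) d :
  F * G != 0 -> F * G \is d.-homog for mf -> exists e, F \is e.-homog for mf.
Proof.
move=> FG0 hFG; have := FG0; rewrite mulf_eq0 negb_or => /andP[F0 G0].
have nz (H : {mpoly R[n]}) : H != 0 -> grade mf H != 0.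
  by apply: contra_neq; exact: grade_eq0.
have [a Fa Fa0] := poly_low_exists (nz _ F0).
have [b Gb Gb0] := poly_low_exists (nz _ G0).
have [_ ab] := coef_low_mul Fa Gb.
have szFG : size (grade mf F * grade mf G) = d.+1.
  by rewrite -rmorphM /= (grade_homog hFG) size_scale ?size_polyXn.
have dab : (d = a + b)%N.
  apply/eqP; apply: contraT => ne; move/eqP: ab.
  rewrite -rmorphM /= (grade_homog hFG) coefZ coefXn [_ == d]eq_sym (negbTE ne).
  by rewrite mulr0 eq_sym mulf_eq0 (negbTE Fa0) (negbTE Gb0).
have la : (a < size (grade mf F))%N.
  by rewrite ltnNge; apply: contra Fa0 => /leq_sizeP ->.
have lb : (b < size (grade mf G))%N.
  by rewrite ltnNge; apply: contra Gb0 => /leq_sizeP ->.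
move: szFG; rewrite size_mul ?nz // => szFG.
have aux x y : (a < x -> b < y -> (x + y).-1 = d.+1 -> x = a.+1)%N by lia.
have szF : size (grade mf F) = a.+1 := aux _ _ la lb szFG.
exists a; have gFE : grade mf F = pihomog mf a F *: 'X^a.
  apply/polyP => i; rewrite coefZ coefXn.
  have [->|ne] := eqVneq i a; first by rewrite mulr1 coef_grade.
  rewrite mulr0; have [/Fa -> //|ai] := ltnP i a.
  by rewrite nth_default // szF ltn_neqAle eq_sym ne.
rewrite (pihomog_partitionE (leqnn (mmeasure mf F))).
rewrite (eq_bigr (fun i : 'I__ => if val i == a then pihomog mf a F else 0)).
  by apply: rpred_sum => i _; case: ifP => _; rewrite ?pihomogP ?rpred0.
move=> i _; rewrite -coef_grade gFE coefZ coefXn.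
by case: eqP; rewrite ?mulr1 ?mulr0.
Qed.

Section LowOrder.
Variable n : nat.

Definition low_order (R : nzRingType) k (G : {mpoly R[n]}) : Prop :=
  forall p, (mdeg p < k)%N -> G@_p = 0.

Lemma low_orderW (R : nzRingType) k l (G : {mpoly R[n]}) :
  (l <= k)%N -> low_order k G -> low_order l G.
Proof. by move=> lk Gk p pl; apply: Gk; apply: leq_trans lk. Qed.

Lemma low_orderD (R : nzRingType) k (F G : {mpoly R[n]}) :
  low_order k F -> low_order k G -> low_order k (F + G).
Proof. by move=> Fk Gk p pk; rewrite mcoeffD Fk ?Gk ?addr0. Qed.

Lemma low_order_grade (R : comNzRingType) k (G : {mpoly R[n]}) :
  low_order k G <-> forall d, (d < k)%N -> (grade mdeg G)`_d = 0.
Proof.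
split=> [Gk d dk|Gk p pk].
  rewrite coef_grade pihomogE big_seq_cond big1 // => m /andP[_ /eqP md].
  by rewrite Gk ?scale0r // md.
rewrite [G](pihomog_partitionE (leqnn (mmeasure mdeg G))) raddf_sum /=.
apply: big1 => i _; have [ik|ki] := ltnP i k.
  by rewrite -coef_grade Gk // mcoeff0.
rewrite (dhomog_nemf_coeff (pihomogP mdeg i G)) //.
by rewrite neq_ltn (leq_trans pk ki).
Qed.

Lemma low_orderM (R : comNzRingType) k l (F G : {mpoly R[n]}) :
  low_order k F -> low_order l G -> low_order (k + l) (F * G).
Proof.
move=> /low_order_grade Fk /low_order_grade Gl; apply/low_order_grade => d dkl.
by rewrite rmorphM; exact: (coef_low_mul Fk Gl).1.
Qed.

Lemma low_order_exists (R : comNzRingType) (F : {mpoly R[n]}) : F != 0 ->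
  exists2 k, low_order k F & ~ low_order k.+1 F.
Proof.
move=> F0; have : grade mdeg F != 0.
  by apply: contra_neq F0; exact: grade_eq0.
move=> /poly_low_exists[a Fa Fa0]; exists a; first exact/low_order_grade.
by move=> /low_order_grade/(_ a (ltnSn a))/eqP; rewrite (negbTE Fa0).
Qed.

(** The lowest form of a product is the product of the lowest forms, and over a domain that of F can
    be cancelled. *)
Lemma low_order_strict (R : idomainType) k l (F G : {mpoly R[n]}) :
  low_order k F -> ~ low_order k.+1 F -> low_order l G ->
  low_order (k + l).+1 (F * G) -> low_order l.+1 G.
Proof.
move=> /low_order_grade Fk nFk /low_order_grade Gl /low_order_grade FG.
apply/low_order_grade => d; rewrite ltnS leq_eqVlt => /orP[/eqP->|/Gl//].
have := FG _ (ltnSn _); rewrite rmorphM (coef_low_mul Fk Gl).2.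
move/eqP; rewrite mulf_eq0 => /orP[/eqP Fk0|/eqP//]; case: nFk.
apply/low_order_grade => e; rewrite ltnS leq_eqVlt => /orP[/eqP->//|/Fk//].
Qed.

Lemma low_order_cancel (R : idomainType) k l (F G : {mpoly R[n]}) :
  ~ low_order k.+1 F -> low_order k F -> low_order (k + l) (F * G) ->
  low_order l G.
Proof.
move=> nFk Fk; elim: l => [_ p //|l IH FG].
apply: (low_order_strict Fk nFk) => //; last by rewrite -addnS.
by apply: IH; apply: low_orderW FG; rewrite addnS.
Qed.

Lemma low_order1N (R : comNzRingType) (F : {mpoly R[n]}) :
  F@_0%MM != 0 -> ~ low_order 1 F.
Proof. by move=> F0 /(_ 0%MM); rewrite mdeg0 => /(_ isT)/eqP; apply/negP. Qed.

End LowOrder.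

Section Translate.
Variable n : nat.

Definition translate (R : comNzRingType) (v : 'I_n -> R) (F : {mpoly R[n]}) :
  {mpoly R[n]} := mmap (@mpolyC n R) (fun i => 'X_i + (v i)%:MP) F.

HB.instance Definition _ (R : comNzRingType) (v : 'I_n -> R) :=
  GRing.RMorphism.copy (translate v)
    (mmap (@mpolyC n R) (fun i => 'X_i + (v i)%:MP)).

(** The divided derivative of F of index p at v. Truncated subtraction is harmless, as
    ['C(g i, p i)] vanishes for g i < p i. *)
Definition tcoef (R : comNzRingType) (v : 'I_n -> R) (p : 'X_{1..n})
    (F : {mpoly R[n]}) : R :=
  \sum_(g <- msupp F) F@_g * \prod_i (v i ^+ (g i - p i) *+ 'C(g i, p i)).

Lemma mcoeff_translate (R : comNzRingType) (v : 'I_n -> R) p F :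
  (translate v F)@_p = tcoef v p F.
Proof.
rewrite /translate /mmap raddf_sum /=; apply: eq_bigr => g _.
rewrite mcoeffCM; congr (_ * _); rewrite /mmap1.
(* A common bound on all exponents: the binomial sums are extended by zeros, so that their product
   expands over functions into ['I_m]. *)
pose m := (mdeg g + mdeg p).+1.
have le_mdeg (q : 'X_{1..n}) i : (q i <= mdeg q)%N.
  by rewrite mdegE (bigD1 i) //= leq_addr.
pose c i j : R := v i ^+ (g i - j) *+ 'C(g i, j).
rewrite (eq_bigr (fun i => \sum_(j < m) (c i j)%:MP * ('X_i : {mpoly R[n]}) ^+ j)).
  rewrite bigA_distr_bigA /= raddf_sum /=.
  have pm i : (p i < m)%N by rewrite ltnS (leq_trans (le_mdeg p i)) ?leq_addl.
  pose f0 := [ffun i => Ordinal (pm i)].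
  rewrite (bigD1 f0) //= big_split /= -rmorph_prod /= mcoeffCM.
  have XE (f : {ffun 'I_n -> 'I_m}) :
      \prod_i ('X_i : {mpoly R[n]}) ^+ f i = 'X_[[multinom val (f i) | i < n]].
    by rewrite mpolyXE_id; apply: eq_bigr => i _; rewrite mnmE.
  rewrite XE mcoeffX [X in _ + X]big1 ?addr0.
    rewrite (_ : [multinom _ | _ < n] = p) ?eqxx ?mulr1. 
      by apply: eq_bigr => i _; rewrite ffunE.
    by apply/mnmP => i; rewrite mnmE ffunE.
  move=> f ff0; rewrite big_split /= -rmorph_prod /= mcoeffCM XE mcoeffX.
  case: eqP => [E|]; last by rewrite mulr0.
  case/eqP: ff0; apply/ffunP => i; apply: val_inj; rewrite ffunE /=.
  by rewrite -E mnmE.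
move=> i _; rewrite addrC exprDn.
have gm : ((g i).+1 <= m)%N by rewrite ltnS (leq_trans (le_mdeg g i)) ?leq_addr.
rewrite [RHS](bigID (fun j : 'I_m => (j < (g i).+1)%N)) /= [X in _ + X]big1.
  rewrite addr0 (big_ord_widen_cond _ xpredT
    (fun j => (v i)%:MP ^+ (g i - j) * 'X_i ^+ j *+ 'C(g i, j)) gm) /=.
  by apply: eq_bigr => j _; rewrite /c rmorphMn rmorphXn /= mulrnAl.
by move=> j; rewrite -leqNgt => gj; rewrite /c bin_small ?mulr0n ?mpolyC0 ?mul0r.
Qed.

Lemma tcoefE (R : comNzRingType) (v : 'I_n -> R) p F (s : seq 'X_{1..n}) :
  uniq s -> {subset msupp F <= s} ->
  tcoef v p F =
    \sum_(g <- s) F@_g * \prod_i (v i ^+ (g i - p i) *+ 'C(g i, p i)).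
Proof.
move=> us sub; rewrite [RHS](bigID (fun g => g \in msupp F)) /= [X in _ + X]big1 ?addr0.
  rewrite -[RHS]big_filter; apply: perm_big; apply: uniq_perm.
  - exact: msupp_uniq.
  - exact: filter_uniq.
  by move=> g; rewrite mem_filter andb_idr //; apply: sub.
by move=> g /memN_msupp_eq0 ->; rewrite mul0r.
Qed.

Lemma translate0 (R : comNzRingType) (v : 'I_n -> R) F :
  (translate v F)@_0%MM = F.@[v].
Proof.
rewrite mcoeff_translate mevalE; apply: eq_bigr => g _; congr (_ * _).
by apply: eq_bigr => i _; rewrite mnm0E subn0 bin0 mulr1n.
Qed.

Lemma translateK (R : comNzRingType) (v w : 'I_n -> R) F :
  (forall i, w i = - v i) -> translate w (translate v F) = F.
Proof.
move=> wv.
have H : translate w \o translate v =1 idfun.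
  apply: (rmorph_mpolyP (u := translate w \o translate v) (u' := idfun)).
    by move=> c; rewrite /= /translate !mmapC.
  move=> i; rewrite /= /translate mmapX mmap1U rmorphD /= mmapC mmapX mmap1U.
  by rewrite wv mpolyCN addrNK.
exact: H.
Qed.

Lemma translate_eq0 (R : comNzRingType) (v : 'I_n -> R) F :
  (translate v F == 0) = (F == 0).
Proof.
apply/eqP/eqP => [F0|->]; last exact: rmorph0.
by rewrite -(@translateK _ v (fun i => - v i) F) // F0 rmorph0.
Qed.

Lemma meval_translate (R : comNzRingType) (v h : 'I_n -> R) F :
  (translate v F).@[h] = F.@[fun i => h i + v i].
Proof.
rewrite /meval /translate rmorph_mmap.
apply: eq_mmap => [c|i] /=; first by rewrite mmapC.
by rewrite rmorphD /= mmapC mmapX mmap1U.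
Qed.

Lemma map_translate (R S : comNzRingType) (u : {rmorphism R -> S})
    (v : 'I_n -> R) F :
  map_mpoly u (translate v F) = translate (u \o v) (map_mpoly u F).
Proof.
rewrite /map_mpoly /translate !rmorph_mmap; apply: eq_mmap => [c|i] /=.
  by rewrite !mmapC.
by rewrite rmorphD /= !mmapX !mmap1U mmapC.
Qed.

(** The divided derivative of index p of a form of weighted degree d is a form of weighted degree d
    - mf p in v. Over a field, multiplicity is therefore constant along an orbit with q nonzero. *)
Lemma tcoef_scale (R : comNzRingType) (mf : measure n) d (v : 'I_n -> R) (q : R)
    p F : F \is d.-homog for mf ->
  tcoef (fun i => v i * q ^+ mf U_(i)%MM) p F = tcoef v p F * q ^+ (d - mf p).
Proof.
move=> /dhomogP Fd; rewrite /tcoef mulr_suml big_seq [RHS]big_seq.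
apply: eq_bigr => g gF; rewrite -mulrA; congr (_ * _).
have [pg|/existsNP[i /negP]] := pselect (forall i, (p i <= g i)%N); last first.
  rewrite -ltnNge => gp; rewrite (bigD1 i) //= [in RHS](bigD1 i) //=.
  by rewrite bin_small // !mulr0n !mul0r.
have -> : (d - mf p = \sum_i (g i - p i) * mf U_(i)%MM)%N.
  have := Fd g gF; rewrite mfE [mf p]mfE => <-.
  rewrite -sumnB; last by move=> i _; rewrite leq_mul2r pg orbT.
  by apply: eq_bigr => i _; rewrite mulnBl.
rewrite expr_sum -big_split /=.
by apply: eq_bigr => i _; rewrite exprMn mulrnAl -exprM mulnC.
Qed.

End Translate.

(** * Specialisation of points *)

Definition multiplicity_ge n (R : comNzRingType) k (v : 'I_n -> R)
    (F : {mpoly R[n]}) : Prop := low_order k (translate v F).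

Lemma multiplicity_geE n (R : comNzRingType) k (v : 'I_n -> R) F :
  multiplicity_ge k v F <-> forall p, (mdeg p < k)%N -> tcoef v p F = 0.
Proof.
by split=> H p /H; rewrite mcoeff_translate.
Qed.

(** Rank cannot grow under specialisation: if [map_mx psi M] had trivial kernel, one of its maximal
    minors would be nonzero, hence so would the same minor of M and, phi being injective, that of
    [map_mx phi M]. *)
Lemma kernel_specialization (A : comNzRingType) (K L : fieldType)
    (phi : {rmorphism A -> K}) (psi : {rmorphism A -> L})
    (phi_inj : forall a, phi a = 0 -> a = 0) p q (M : 'M[A]_(p, q))
    (c : 'cV[K]_q) :
  c != 0 -> map_mx phi M *m c = 0 ->
  exists2 c' : 'cV[L]_q, c' != 0 & map_mx psi M *m c' = 0.
Proof.
move=> c0 Mc; apply: contrapT => noL.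
have full : row_full (map_mx psi M).
  rewrite /row_full -mxrank_tr; apply: inj_row_free => v /(congr1 trmx).
  rewrite trmx_mul trmxK trmx0 => Mv; apply: trmx_inj; rewrite trmx0.
  by apply: contrapT => /eqP v0; apply: noL; exists v^T.
set f := fullrankfun full.
have detL : \det (rowsub f (map_mx psi M)) != 0.
  by rewrite -unitfE -unitmxE; exact: fullrowsub_unit.
have detA : \det (rowsub f M) != 0.
  by apply: contra_neq detL => detA0; rewrite -map_mxsub det_map_mx detA0 rmorph0.
have detK : \det (rowsub f (map_mx phi M)) != 0.
  by rewrite -map_mxsub det_map_mx; apply: contra_neq detA => /phi_inj.
have uK : rowsub f (map_mx phi M) \in unitmx by rewrite unitmxE unitfE.
case/eqP: c0; rewrite -(mulKmx uK c) mul_rowsub_mx Mc.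
by rewrite (_ : rowsub f 0 = 0) ?mulmx0 //; apply/matrixP => i j; rewrite !mxE.
Qed.

Lemma multiplicity_specialization (A : comNzRingType) (K L : fieldType)
    (phi : {rmorphism A -> K}) (psi : {rmorphism A -> L})
    (phi_inj : forall a, phi a = 0 -> a = 0) (I : finType) n
    (V : I -> 'I_n -> A) d m (F : {mpoly K[n]}) :
  F != 0 -> F \is d.-homog -> (forall i, multiplicity_ge m (phi \o V i) F) ->
  exists F' : {mpoly L[n]}, [/\ F' != 0, F' \is d.-homog
    & forall i, multiplicity_ge m (psi \o V i) F'].
Proof.
move=> F0 /dhomogP Fd Fm.
(* Columns are the monomials of degree d, rows the pairs of a point and an index p with
   [mdeg p < m]. *)
pose C := {g : 'X_{1..n < d.+1} | mdeg g == d}.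
pose mon (j : 'I_#|{: C}|) : 'X_{1..n} := val (val (enum_val j)).
pose Rw := (I * 'X_{1..n < m})%type.
pose E (B : comNzRingType) (v : 'I_n -> B) (p g : 'X_{1..n}) :=
  \prod_e (v e ^+ (g e - p e) *+ 'C(g e, p e)).
pose M := \matrix_(i < #|{: Rw}|, j < #|{: C}|)
  E A (V (enum_val i).1) (val (enum_val i).2) (mon j).
have ME (B : comNzRingType) (u : {rmorphism A -> B}) i j : map_mx u M i j =
    E B (u \o V (enum_val i).1) (val (enum_val i).2) (mon j).
  rewrite !mxE /E rmorph_prod; apply: eq_bigr => e _.
  by rewrite rmorphMn rmorphXn.
pose s := [seq mon j | j <- enum 'I_#|{: C}|].
have mon_inj : injective mon.
  by move=> i j /val_inj/val_inj/enum_val_inj.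
have us : uniq s by rewrite map_inj_uniq ?enum_uniq.
have mems g : (mdeg g == d) = (g \in s).
  apply/idP/mapP => [gd|[j _ ->]]; last exact: (svalP (enum_val j)).
  have gd1 : (mdeg g < d.+1)%N by rewrite (eqP gd).
  exists (enum_rank (Sub (BMultinom gd1) gd : C)); first by rewrite mem_enum.
  by rewrite /mon enum_rankK.
have kerE (B : fieldType) (u : {rmorphism A -> B}) (G : {mpoly B[n]}) :
    G \is d.-homog ->
    map_mx u M *m (\col_j G@_(mon j)) = 0 <->
    forall i, multiplicity_ge m (u \o V i) G.
  move=> /dhomogP Gd.
  have sub : {subset msupp G <= s} by move=> g /Gd gd; rewrite -mems gd.
  have tE i p : tcoef (u \o V i) p G =
      \sum_j E B (u \o V i) p (mon j) * G@_(mon j).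
    rewrite (tcoefE _ _ us sub) big_map big_enum /=.
    by apply: eq_bigr => j _; rewrite mulrC.
  split=> [K0 i|H].
    apply/multiplicity_geE => p pm.
    have := congr1 (fun X : 'cV[B]_ _ => X (enum_rank (i, BMultinom pm)) 0) K0.
    rewrite tE [RHS]mxE mxE => K0i; rewrite -[RHS]K0i; apply: eq_bigr => j _.
    by rewrite ME mxE enum_rankK.
  apply/colP => i; rewrite [RHS]mxE.
  have pm := bmdeg (enum_val i).2.
  have /multiplicity_geE/(_ _ pm) <- := H (enum_val i).1.
  by rewrite tE mxE; apply: eq_bigr => j _; rewrite ME mxE.
have c0 : \col_j F@_(mon j) != 0.
  apply: contra_neq F0 => cF; apply/mpolyP => g; rewrite mcoeff0.
  have [/eqP|gd] := boolP (mdeg g == d); last first.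
    by apply: memN_msupp_eq0; apply: contra gd => /Fd ->.
  move/eqP; rewrite mems => /mapP[j _ ->].
  by have := congr1 (fun X : 'cV[K]_ _ => X j 0) cF; rewrite !mxE.
have [|c' c'0 Mc'] := kernel_specialization psi phi_inj c0 (M := M).
  by apply/kerE => //; apply/dhomogP.
pose G : {mpoly L[n]} := \sum_j c' j 0 *: 'X_[mon j].
have GE j : G@_(mon j) = c' j 0.
  rewrite raddf_sum /= (bigD1 j) //= mcoeffZ mcoeffX eqxx mulr1 big1 ?addr0 //.
  move=> i ij; rewrite mcoeffZ mcoeffX (inj_eq mon_inj) (negbTE ij).
  by rewrite mulr0.
have Gd : G \is d.-homog.
  apply: rpred_sum => j _; apply: dhomogZ; rewrite dhomogX mems.
  by apply/map_f; rewrite mem_enum.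
exists G; split => //.
  apply: contra_neq c'0 => G0; apply/colP => j.
  by rewrite -GE G0 mcoeff0 mxE.
apply/kerE => //; rewrite (_ : \col_j _ = c') //.
by apply/colP => j; rewrite mxE GE.
Qed.

(** * Unique factorisation of polynomials *)

Section Factorization.
Variable A : idomainType.
Implicit Types a b c p q u : A.

Definition divides a b : Prop := exists c, b = c * a.

Definition prime_element p : Prop :=
  [/\ p != 0, p \isn't a GRing.unit &
      forall a b, divides p (a * b) -> divides p a \/ divides p b].

Definition factorable a : Prop := exists (u : A) (s : seq A),
  [/\ u \is a GRing.unit, forall p, p \in s -> prime_element p
    & a = u * \prod_(p <- s) p].

(** The factors are prime rather than irreducible, which contains uniqueness. *)
Definition factorial : Prop := forall a, a != 0 -> factorable a.

Lemma factorableM a b : factorable a -> factorable b -> factorable (a * b).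
Proof.
move=> [u [s [uu sp ->]]] [v [t [vu tp ->]]]; exists (u * v), (s ++ t).
split; first by rewrite unitrM uu.
  by move=> p; rewrite mem_cat => /orP[/sp|/tp].
by rewrite big_cat /= mulrACA.
Qed.

Lemma factorable_unit u : u \is a GRing.unit -> factorable u.
Proof. by move=> uu; exists u, [::]; split=> //; rewrite big_nil mulr1. Qed.

Lemma factorable_prime p : prime_element p -> factorable p.
Proof.
move=> pp; exists 1, [:: p]; rewrite unitr1 big_seq1 mul1r; split=> // q.
by rewrite inE => /eqP ->.
Qed.

Lemma divides_mull a b c : divides a b -> divides a (c * b).
Proof. by move=> [d ->]; exists (c * d); rewrite mulrA. Qed.

Lemma prime_divides_prod p (s : seq A) : prime_element p ->
  divides p (\prod_(q <- s) q) -> exists2 q, q \in s & divides p q.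
Proof.
move=> [_ pu pP]; elim: s => [|q s IH].
  rewrite big_nil => -[c c1]; case/negP: pu; apply/unitrP; exists c.
  by rewrite [p * c]mulrC -c1.
rewrite big_cons => /pP[pq|/IH[r rs pr]]; first by exists q; rewrite ?mem_head.
by exists r; rewrite // inE rs orbT.
Qed.

Lemma unit_dividesN p u : prime_element p -> u \is a GRing.unit ->
  ~ divides p u.
Proof.
move=> [_ pu _] uu [c uE]; case/negP: pu.
by move: uu; rewrite uE unitrM => /andP[].
Qed.

(** The prime p divides some q in s and is therefore associated to it. The drop in size drives the
    induction of [primitive_part]. *)
Lemma prime_cancel p b u (s : seq A) : prime_element p ->
  u \is a GRing.unit -> (forall q, q \in s -> prime_element q) ->
  b * p = u * \prod_(q <- s) q ->
  exists (v : A) (t : seq A), [/\ v \is a GRing.unit,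
    forall q, q \in t -> prime_element q, (size t < size s)%N
    & b = v * \prod_(q <- t) q].
Proof.
move=> pp uu sp E; have [p0 pu pP] := pp.
have /pP[/(unit_dividesN pp uu)//|/(prime_divides_prod pp)[q qs [x qx]]] :
  divides p (u * \prod_(q <- s) q) by exists b.
have [q0 qu qP] := sp q qs.
have /qP[[y xy]|[y py]] : divides q (x * p) by exists 1; rewrite mul1r qx.
  case/negP: pu; apply/unitrP; exists y; rewrite [p * y]mulrC.
  suff : y * p = 1 by [].
  by apply: (mulIf q0); rewrite mul1r {2}qx xy mulrAC.
have xy1 : x * y = 1.
  by apply: (mulIf q0); rewrite mul1r -mulrA -py -qx.
exists (u * x), (rem q s); split.
- by rewrite unitrM uu; apply/unitrP; exists y; rewrite mulrC xy1.
- by move=> r /mem_rem /sp.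
- by rewrite size_rem //; case: (s) qs.
apply: (mulIf p0); rewrite E (perm_big _ (perm_to_rem qs)) big_cons /= qx.
by rewrite -!mulrA; congr (_ * (_ * _)); rewrite mulrC.
Qed.

End Factorization.

Section GaussLemma.
Variable A : idomainType.
Implicit Types (a c p : A) (f g e : {poly A}).

(** If p divides neither f nor g, let f_i and g_k be their first coefficients not divisible by p;
    the coefficient of f g at i + k is f_i g_k plus multiples of p. *)
Lemma polyC_prime p : prime_element p -> prime_element p%:P.
Proof.
move=> [p0 pu pP]; split; first by rewrite polyC_eq0.
  by rewrite poly_unitE coefC eqxx negb_and pu orbT.
have low f : ~ divides p%:P f -> exists i,
    ~ divides p f`_i /\ forall j, (j < i)%N -> divides p f`_j.
  move=> nf; have ex : exists i, `[< ~ divides p f`_i >].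
    apply: contrapT => /forallNP nex; apply: nf.
    have dv i : divides p f`_i.
      by apply: contrapT => ndv; apply: (nex i); apply/asboolP.
    pose g i := projT1 (cid (dv i)).
    have gE i : f`_i = g i * p by rewrite /g; case: cid.
    exists (\poly_(i < size f) g i); apply/polyP => i; rewrite coefMC coef_poly.
    by case: ltnP => [_|/(nth_default 0) ->]; rewrite ?gE ?mul0r.
  exists (ex_minn ex); case: ex_minnP => i /asboolP ni imin; split=> // j ji.
  apply: contrapT => nj; have /asboolP/imin := nj.
  by rewrite leqNgt ji.
move=> f g [h fgh]; apply: contrapT => /not_orP[/low[i [fi fj]] /low[k [gk gj]]].
have dvD a b : divides p a -> divides p b -> divides p (a + b).
  by move=> [x ->] [y ->]; exists (x + y); rewrite mulrDl.
have dvB a b : divides p (a + b) -> divides p b -> divides p a.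
  move=> [x abE] [y bE]; exists (x - y); rewrite mulrBl -abE -bE.
  by rewrite addrK.
have : divides p (f`_i * g`_k).
  have : divides p (f * g)`_(i + k) by rewrite fgh coefMC; exists h`_(i + k).
  have li : (i < (i + k).+1)%N by rewrite ltnS leq_addr.
  rewrite coefM (bigD1 (Ordinal li)) //= addKn => /dvB; apply.
  elim/big_ind: _ => [|x y|j]; first by exists 0; rewrite mul0r.
    exact: dvD.
  rewrite -val_eqE /= => ji; have [/fj|ij] := ltnP j i.
    by rewrite mulrC => ?; exact: divides_mull.
  by apply: divides_mull; apply: gj; have := ltn_ord j; lia.
by case/pP.
Qed.

(** Over a ring without primes, such as a field, every polynomial is primitive, even 0; hence the
    separate nonvanishing assumptions below. *)
Definition primitive f : Prop :=
  forall p, prime_element p -> ~ divides p%:P f.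

Hypothesis A_factorial : factorial A.

(** The primes of a are removed one by one: each stays prime as a constant polynomial and does not
    divide e, so it divides the cofactor. *)
Lemma primitive_cancel e a f : primitive e -> a != 0 ->
  divides e (a%:P * f) -> divides e f.
Proof.
move=> ep /A_factorial[u [s [uu sp ->]]]; elim: s sp f => [_|p s IH sp] f.
  rewrite big_nil mulr1 => -[q E]; exists ((u^-1)%:P * q).
  by rewrite -mulrA -E mulrA -polyCM mulVr // mul1r.
rewrite big_cons mulrCA polyCM -mulrA => -[q E].
have pp : prime_element p by apply: sp; rewrite mem_head.
have [p0 _ pP] := polyC_prime pp.
have /pP[[r qE]|/(ep p pp)//] : divides p%:P (q * e).
  by rewrite -E; eexists; rewrite mulrC.
apply: IH; first by move=> x xs; apply: sp; rewrite inE xs orbT.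
by exists r; apply: (mulfI p0); rewrite E qE -mulrA mulrCA.
Qed.

(** Constant primes are extracted as long as possible; each one takes a factor away from the leading
    coefficient. *)
Lemma primitive_part f : f != 0 ->
  exists c g, [/\ c != 0, primitive g & f = c%:P * g].
Proof.
move=> f0; have := f0; rewrite -lead_coef_eq0.
move=> /A_factorial[u [s [uu sp]]].
have [n] := ubnP (size s); elim: n u s f f0 uu sp => // n IH u s f f0 uu sp sn E.
have [fp|] := pselect (primitive f).
  by exists 1, f; split=> //; rewrite ?oner_neq0 // mul1r.
move=> /existsNP[p /not_implyP[pp /contrapT[g fE]]].
have [p0 pu pP] := pp.
have g0 : g != 0 by apply: contra_neq f0 => g0; rewrite fE g0 mul0r.
have lE : lead_coef g * p = u * \prod_(q <- s) q.
  by rewrite -E fE lead_coefM lead_coefC.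
have [v [t [vu tp ts gE]]] := prime_cancel pp uu sp lE.
have [|c [h [c0 hp gE']]] := IH v t g g0 vu tp _ gE.
  exact: leq_trans ts _.
exists (c * p), h; split=> //; first by rewrite mulf_neq0.
by rewrite fE gE' polyCM mulrAC.
Qed.

Lemma primitive_const e : primitive e -> e != 0 -> (size e <= 1)%N ->
  e \is a GRing.unit.
Proof.
move=> ep e0 /size1_polyC eE; rewrite poly_unitE eE size_polyC coefC eqxx /=.
have a0 : e`_0 != 0 by rewrite -polyC_eq0 -eE.
rewrite a0 /=; have [u [[|p s] [uu sp aE]]] := A_factorial a0.
  by rewrite aE big_nil mulr1.
case: (ep p); first by apply: sp; rewrite mem_head.
rewrite eE aE big_cons mulrCA polyCM; exists (u * \prod_(q <- s) q)%:P.
by rewrite mulrC.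
Qed.

(* For f | gh with f not dividing g, the primitive part of an element of least
   degree in the ideal (f, g) divides both f and g, hence is a unit. *)
Lemma primitive_prime f : primitive f -> (1 < size f)%N ->
  (forall g h, f = g * h -> (size g <= 1)%N \/ (size h <= 1)%N) ->
  prime_element f.
Proof.
move=> fp sf firr; have f0 : f != 0 by rewrite -size_poly_gt0 (leq_trans _ sf).
split=> //; first by rewrite poly_unitE negb_and neq_ltn sf orbT.
move=> g h [k ghk].
have [dg|ndg] := pselect (divides f g); [by left|right].
pose comb e := exists x y, e = x * f + y * g.
have combf : comb f by exists 1, 0; rewrite mul1r mul0r addr0.
have combg : comb g by exists 0, 1; rewrite mul1r mul0r add0r.
have combD e x : comb e -> forall y, comb y -> comb (y - x * e).
  move=> [a [b ->]] _ [c [d ->]]; exists (c - x * a), (d - x * b).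
  by rewrite mulrDr !mulrBl !mulrA opprD addrACA.
have combM e x : comb e -> comb (x * e).
  by move=> [a [b ->]]; exists (x * a), (x * b); rewrite mulrDr !mulrA.
have ex : exists n, `[< exists e, [/\ e != 0, comb e & size e = n] >].
  by exists (size f); apply/asboolP; exists f.
case: (ex_minnP ex) => n /asboolP[e [e0 ce se]] emin.
have [c [e1 [c0 e1p eE]]] := primitive_part e0.
have e10 : e1 != 0 by apply: contra_neq e0 => e10; rewrite eE e10 mulr0.
have se1 : size e1 = n by rewrite -se eE mul_polyC size_scale.
have dive y : comb y -> divides e1 y.
  (* Pseudo-division gives l y = q e1 + r. Multiplied by c this reads c l y = q e + c r, so c r is a
     combination smaller than e, hence 0. *)
  move=> cy; have := Pdiv.Idomain.divp_eq y e1.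
  set l := _ ^+ _; set q := _ %/ _; set r := _ %% _ => yE.
  have l0 : l != 0 by rewrite expf_neq0 // lead_coef_eq0.
  have cr : comb (c%:P * r).
    have -> : c%:P * r = (c * l)%:P * y - q * e.
      rewrite eE mulrCA polyCM -mulrA -mulrBr [l%:P * y]mul_polyC yE.
      by rewrite addrAC subrr add0r.
    by apply: (combD _ _ ce); apply: combM.
  have r0 : r = 0.
    apply: contrapT => /eqP r0.
    have : (n <= size (c%:P * r)%R)%N.
      apply: emin; apply/asboolP; exists (c%:P * r); split=> //.
      by rewrite mulf_neq0 // polyC_eq0.
    by rewrite mul_polyC size_scale // leqNgt -se1 ltn_modp e10.
  apply: (primitive_cancel e1p l0); exists q.
  by rewrite mul_polyC yE r0 addr0.
have [q fE] := dive f combf.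
have [sq|se1'] := firr q e1 fE.
  case: ndg; have [x ->] := dive g combg.
  have q0 : q != 0 by apply: contra_neq f0 => q0; rewrite fE q0 mul0r.
  have qu : q \is a GRing.unit.
    apply: primitive_const => // p pp [y qE]; apply: (fp p pp).
    by exists (y * e1); rewrite fE qE mulrAC.
  by exists (x * q^-1); rewrite fE -mulrA mulKr.
have e1u := primitive_const e1p e10 se1'.
have [x [y exy]] := ce.
(* From c e1 = x f + y g and g h = k f follows c h = e1^-1 (x h + y k) f, and f is primitive. *)
apply: (primitive_cancel fp c0); exists (e1^-1 * (x * h + y * k)).
rewrite -[c%:P](mulrK e1u) -eE exy -!mulrA mulrC -!mulrA; congr (_ * _).
rewrite !mulrDr !mulrDl; congr (_ + _); first by rewrite mulrCA -mulrA mulrCA mulrC.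
by rewrite mulrCA [h * g]mulrC ghk mulrA mulrC.
Qed.

Lemma poly_factorial : factorial {poly A}.
Proof.
move=> f f0; have [n] := ubnP (size f); elim: n f f0 => // n IH f f0 fn.
have [c [g [c0 gp fE]]] := primitive_part f0.
have cf : factorable c%:P.
  have [u [s [uu sp ->]]] := A_factorial c0.
  exists u%:P, [seq p%:P | p <- s]; split.
  - rewrite poly_unitE size_polyC coefC eqxx uu andbT eqb1.
    by apply: contraTneq uu => ->; rewrite unitr0.
  - by move=> _ /mapP[p /sp pp ->]; exact: polyC_prime.
  by rewrite polyCM rmorph_prod big_map.
rewrite fE; apply: factorableM => //.
have g0 : g != 0 by apply: contra_neq f0 => g0; rewrite fE g0 mulr0.
have sg : size g = size f by rewrite fE mul_polyC size_scale.
have [sg1|sg1] := leqP (size g) 1.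
  exact/factorable_unit/primitive_const.
have [irr|] := pselect
    (forall h k, g = h * k -> (size h <= 1)%N \/ (size k <= 1)%N).
  exact/factorable_prime/primitive_prime.
move=> /existsNP[h /existsNP[k /not_implyP[gE /not_orP[/negP hs /negP ks]]]].
have := g0; rewrite gE mulf_eq0 negb_or => /andP[h0 k0].
rewrite -ltnNge in hs; rewrite -ltnNge in ks.
move: sg; rewrite gE size_mul // => sg.
have aux x y z : (1 < x -> 1 < y -> (x + y).-1 = z -> z < n.+1 ->
  (x < n) && (y < n))%N by lia.
have /andP[hn kn] := aux _ _ _ hs ks sg fn.
by apply: factorableM; apply: IH.
Qed.

End GaussLemma.

Lemma factorial_iso (A B : idomainType) (u : {rmorphism A -> B})
    (w : {rmorphism B -> A}) :
  cancel u w -> cancel w u -> factorial B -> factorial A.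
Proof.
move=> uK wK fB a a0.
have ua0 : u a != 0 by rewrite -(rmorph0 u) (can_eq uK).
have [x [s [xu sp E]]] := fB _ ua0.
exists (w x), [seq w p | p <- s]; split.
- exact: rmorph_unit.
- move=> _ /mapP[p /sp[p0 pu pP] ->]; split.
  + by rewrite -(rmorph0 w) (can_eq wK).
  + by apply: contra pu => /(rmorph_unit u); rewrite wK.
  move=> b c [d bcd].
  have /pP[] : divides p (u b * u c).
  - by exists (u d); rewrite -rmorphM bcd rmorphM /= wK.
  - by move=> [e ue]; left; exists (w e); rewrite -rmorphM -ue uK.
  - by move=> [e ue]; right; exists (w e); rewrite -rmorphM -ue uK.
by rewrite big_map -rmorph_prod -rmorphM -E uK.
Qed.

Section MpolyFactorial.

(** Inverse of [muni]: polynomials in n + 1 variables are polynomials in the last one over those in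
    n variables, which feeds the induction for factoriality. *)
Definition mmulti_horner n (R : comNzRingType) (p : {poly {mpoly R[n]}}) :
  {mpoly R[n.+1]} := (map_poly (@mwiden n R) p).['X_ord_max].

HB.instance Definition _ n (R : comNzRingType) :=
  GRing.RMorphism.copy (@mmulti_horner n R)
    (horner_eval 'X_ord_max \o map_poly (@mwiden n R)).

Lemma muni_widen n (R : comNzRingType) (i : 'I_n) :
  muni ('X_(widen_ord (leqnSn n) i) : {mpoly R[n.+1]}) = ('X_i)%:P.
Proof.
rewrite muniE msuppX big_seq1 mcoeffX eqxx scale1r mnm1E -val_eqE /=.
rewrite (ltn_eqF (ltn_ord i)) expr0 alg_polyC; congr (_%:P); congr 'X_[_].
by apply/mnmP => j; rewrite mnmE !mnm1E -!val_eqE.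
Qed.

Lemma muni_max n (R : comNzRingType) :
  muni ('X_ord_max : {mpoly R[n.+1]}) = 'X.
Proof.
rewrite muniE msuppX big_seq1 mcoeffX eqxx scale1r mnm1E eqxx expr1.
rewrite (_ : [multinom _ | i < n] = 0%MM) ?mpolyX0 ?scale1r //.
apply/mnmP => j; rewrite mnmE mnm1E mnm0E -val_eqE /= eq_sym.
by rewrite (ltn_eqF (ltn_ord j)).
Qed.

Lemma muniK n (R : comNzRingType) :
  cancel (@muni n R) (@mmulti_horner n R).
Proof.
have H : @mmulti_horner n R \o @muni n R =1 idfun.
  apply: (rmorph_mpolyP (u := @mmulti_horner n R \o @muni n R)
                        (u' := idfun)) => [c|i] /=.
    by rewrite muniC /mmulti_horner map_polyC hornerC /= mwidenC.
  have [ni|ni] := ltnP i n.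
    have -> : i = widen_ord (leqnSn n) (Ordinal ni) by apply: val_inj.
    rewrite muni_widen /mmulti_horner map_polyC hornerC /= mwidenX mnmwiden1.
    by [].
  have -> : i = ord_max.
    by apply: val_inj; apply/eqP; rewrite eqn_leq ni -ltnS ltn_ord.
  by rewrite muni_max /mmulti_horner map_polyX hornerX.
exact: H.
Qed.

Lemma mmulti_hornerK n (R : comNzRingType) :
  cancel (@mmulti_horner n R) (@muni n R).
Proof.
have mwK : @muni n R \o @mwiden n R =1 polyC.
  apply: (rmorph_mpolyP (u := @muni n R \o @mwiden n R) (u' := polyC))
    => [c|i] /=; first by rewrite mwidenC muniC.
  by rewrite mwidenX mnmwiden1 -muni_widen.
move=> p; rewrite /mmulti_horner -[RHS]coefK poly_def horner_coef.
rewrite size_map_inj_poly; [|exact: inj_mwiden|exact: mwiden0].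
rewrite rmorph_sum; apply: eq_bigr => i _; rewrite rmorphM rmorphXn /=.
by rewrite muni_max coef_map -mul_polyC; congr (_ * _); exact: mwK.
Qed.

Lemma mpoly_factorial n (R : fieldType) : factorial {mpoly R[n]}.
Proof.
elim: n => [|n IH].
  move=> F F0; apply: factorable_unit; move: F0; rewrite [F]nvar0_mpolyC.
  by rewrite mpolyC_eq0 -unitfE; exact: rmorph_unit.
exact: (factorial_iso (@muniK n R) (@mmulti_hornerK n R) (poly_factorial IH)).
Qed.

End MpolyFactorial.

(** * The Nullstellensatz over the complex numbers *)

Section Uncountable.
Variable R : realType.
Local Open Scope classical_set_scope.

Lemma subinterval_avoid (a b : R) (s : seq R) : a < b ->
  exists a' b', [/\ a <= a', a' < b', b' <= b
    & forall x, x \in s -> ~ (a' <= x <= b')].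
Proof.
move=> ab; elim: s => [|y s [a' [b' [aa ab' bb IH]]]]; first by exists a, b.
pose m := (a' + b') / 2; pose t := (a' + m) / 2.
have am : a' < m by rewrite /m ltr_pdivlMr // mulr_natr mulr2n ltrD2l.
have mb : m < b' by rewrite /m ltr_pdivrMr // mulr_natr mulr2n ltrD2r.
have at' : a' < t by rewrite /t ltr_pdivlMr // mulr_natr mulr2n ltrD2l.
have tm : t < m by rewrite /t ltr_pdivrMr // mulr_natr mulr2n ltrD2r.
(* If y < m, the right half avoids y; otherwise the left quarter does, since it ends strictly below
   m. *)
have [ym|my] := ltP y m.
  exists m, b'; split=> //; first exact: le_trans (ltW am).
  move=> x; rewrite inE => /orP[/eqP->|xs] /andP[mx xb].
    by move: mx; rewrite leNgt ym.
  by apply: (IH x xs); rewrite xb (le_trans (ltW am)).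
exists a', t; split=> //; first exact: le_trans (ltW tm) (le_trans (ltW mb) bb).
move=> x; rewrite inE => /orP[/eqP->|xs] /andP[ax xt].
  by move: (le_lt_trans (le_trans my xt) tm); rewrite ltxx.
by apply: (IH x xs); rewrite ax (le_trans xt) ?(ltW (lt_trans tm mb)).
Qed.

(* Nested intervals: otherwise the reals are a countable union of finite
   fibres. *)
Lemma real_infinite_fibre (N : R -> nat) :
  exists k, forall s : seq R, exists2 x, x \notin s & N x = k.
Proof.
apply: contrapT => /forallNP fin.
have {}fin k : exists s : seq R, forall x, N x = k -> x \in s.
  have /existsNP[s sk] := fin k; exists s => x Nx.
  by apply: contrapT => xs; apply: sk; exists x => //; apply/negP.
have [S SP] := choice fin.
have step (z : nat * (R * R)) : exists ab : R * R, z.2.1 < z.2.2 ->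
    [/\ z.2.1 <= ab.1, ab.1 < ab.2, ab.2 <= z.2.2
      & forall x, x \in S z.1 -> ~ (ab.1 <= x <= ab.2)].
  have [lt|_] := ltP z.2.1 z.2.2; last by exists (0, 0).
  by have [a' [b' H]] := subinterval_avoid (S z.1) lt; exists (a', b').
have [f fP] := choice step.
pose J := fix J k := if k is k'.+1 then f (k', J k') else (0, 1).
have Jlt k : (J k).1 < (J k).2.
  by elim: k => [|k IH] /=; [exact: ltr01|have [] := fP (k, J k) IH].
have Jmono k l : (k <= l)%N -> (J k).1 <= (J l).1 /\ (J l).2 <= (J k).2.
  move=> /subnK <-; elim: (l - k)%N => [|i [IH1 IH2]]; first by rewrite add0n.
  rewrite addSn /=; have [j1 _ j2 _] := fP ((i + k)%N, J (i + k)%N) (Jlt _).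
  by split; [exact: le_trans IH1 j1|exact: le_trans j2 IH2].
have Jcross k l : (J k).1 <= (J l).2.
  have [_ H] := Jmono l (maxn k l) (leq_maxr _ _).
  have [H' _] := Jmono k (maxn k l) (leq_maxl _ _).
  exact: le_trans H' (le_trans (ltW (Jlt _)) H).
pose E : set R := [set y | exists k, y = (J k).1].
have E0 : E !=set0 by exists (J 0%N).1, 0%N.
have Eub l : ubound E (J l).2 by move=> _ [k ->].
pose x := sup E.
have xin k : (J k).1 <= x <= (J k).2.
  apply/andP; split; last exact: ge_sup.
  by apply: ub_le_sup; [exists (J 0%N).2|exists k].
(* The point x lies in all intervals, yet the one built at stage N x avoids [S (N x)], which
   contains x. *)
have [_ _ _ avoid] := fP (N x, J (N x)) (Jlt (N x)).
exact: avoid (SP _ _ (erefl _)) (xin (N x).+1).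
Qed.

Lemma complex_infinite_fibre (N : R[i] -> nat) :
  exists k, forall s : seq R[i], exists2 x, x \notin s & N x = k.
Proof.
have [k kP] := real_infinite_fibre (fun x => N (Complex x 0)).
exists k => s; have [x xs Nx] := kP [seq complex.Re z | z <- s].
exists (Complex x 0) => //; apply: contra xs => xs.
by apply/mapP; exists (Complex x 0).
Qed.

End Uncountable.

Section Ideals.
Variable S : comNzRingType.
Local Open Scope classical_set_scope.

Definition is_ideal (I : set S) : Prop :=
  [/\ I 0, forall x y, I x -> I y -> I (x + y)
    & forall a x, I x -> I (a * x)].

Lemma is_ideal_sum (I : set S) (T : Type) (r : seq T) (F : T -> S) :
  is_ideal I -> (forall i, I (F i)) -> I (\sum_(i <- r) F i).
Proof. by move=> [I0 ID _] IF; elim/big_ind: _. Qed.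

Lemma prime_ideal_is_ideal (I : set S) : prime_ideal I -> is_ideal I.
Proof.
move=> [[I0 _ IM] _]; move: I0; rewrite inE => I0.
have IM' x f g : I f -> I g -> I (x * f + g).
  by move=> If Ig; have := IM x f g; rewrite !inE; apply.
split=> // [f g If Ig|x f If]; first by rewrite -[f]mul1r; apply: IM'.
by rewrite -[_ * _]addr0; apply: IM'.
Qed.

Lemma prime_idealP (I : set S) : prime_ideal I ->
  ~ I 1 /\ forall f g, I (f * g) -> I f \/ I g.
Proof.
move=> [[_ I1 _] Ip]; split; first by move=> H; case/negP: I1; rewrite inE.
move=> f g Ifg; have := Ip f g; rewrite !inE => /(_ Ifg)/orP.
by rewrite !inE.
Qed.

Lemma prime_ideal_exp (I : set S) f k : prime_ideal I -> I (f ^+ k) -> I f.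
Proof.
move=> /prime_idealP[I1 Ip]; elim: k => [/I1//|k IH].
by rewrite exprS => /Ip[].
Qed.

End Ideals.

Section Nullstellensatz.
Variables (K : closedFieldType) (n : nat).
Hypothesis infinite_fibre : forall N : K -> nat,
  exists k, forall s : seq K, exists2 x, x \notin s & N x = k.

Local Notation S := {mpoly K[n]}.
Local Open Scope classical_set_scope.

Lemma maximal_ideal_exists (I : set S) : is_ideal I -> ~ I 1 ->
  exists M : set S, [/\ is_ideal M, I `<=` M, ~ M 1
    & forall f, ~ M f -> exists g, M (g * f - 1)].
Proof.
move=> idI I1.
pose P (X : set S) := X = set0 \/ [/\ is_ideal X, I `<=` X & ~ X 1].
have PI : P I by right; split.
have [|M [PM Mmax]] := @Zorn_bigcup _ P.
  move=> F FP Ftot.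
  have [[X [FX X0]]|none] := pselect (exists X, F X /\ X <> set0); last first.
    left; apply/seteqP; split=> // x [X FX Xx]; case: none; exists X; split=> //.
    by move=> X0; rewrite X0 in Xx.
  have FPX Y y : F Y -> Y y -> [/\ is_ideal Y, I `<=` Y & ~ Y 1].
    by move=> /FP[->|//].
  have [x Xx] : exists x, X x.
    by apply: contrapT => /forallNP nX; apply: X0; apply/seteqP; split=> // x /nX.
  have [[X00 _ _] IX _] := FPX X x FX Xx.
  right; split; last 2 first.
  - by move=> y /IX Xy; exists X.
  - by move=> [Y FY Y1]; have [_ _] := FPX Y _ FY Y1.
  split; first by exists X.
    move=> y z [Y FY Yy] [Z FZ Zz].
    have [YZ|ZY] := Ftot Y Z FY FZ.
      exists Z => //; have [[_ ZD _] _ _] := FPX Z _ FZ Zz.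
      by apply: ZD => //; exact: YZ.
    exists Y => //; have [[_ YD _] _ _] := FPX Y _ FY Yy.
    by apply: YD => //; exact: ZY.
  move=> a y [Y FY Yy]; exists Y => //.
  by have [[_ _ YM] _ _] := FPX Y _ FY Yy; exact: YM.
have [idM IM M1] : [/\ is_ideal M, I `<=` M & ~ M 1].
  case: PM => [M0|//]; exfalso; apply: (Mmax I) => //.
  by rewrite M0; split=> // I0; case: idI => /I0.
exists M; split=> // f nMf; apply: contrapT => /forallNP nog.
have [M0 MD MM] := idM.
pose B : set S := [set h | exists x g, M x /\ h = x + g * f].
apply: (Mmax B).
  split; first by move=> x Mx; exists x, 0; rewrite mul0r addr0.
  move=> BM; apply: nMf; apply: BM; exists 0, 1; rewrite mul1r add0r.
  by split.
right; split.
- split; first by exists 0, 0; rewrite mul0r addr0.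
    move=> _ _ [x [g [Mx ->]]] [y [h [My ->]]]; exists (x + y), (g + h).
    by split; [exact: MD|rewrite mulrDl addrACA].
  move=> a _ [x [g [Mx ->]]]; exists (a * x), (a * g).
  by split; [exact: MM|rewrite mulrDr mulrA].
- by move=> x /IM Mx; exists x, 0; rewrite mul0r addr0.
move=> [x [g [Mx E]]]; apply: (nog g).
rewrite (_ : g * f - 1 = -1 * x); first exact: MM.
by rewrite mulN1r E opprD addrC subrK.
Qed.

Section MaximalIdeal.
Variable M : set S.
Hypotheses (idM : is_ideal M) (M1 : ~ M 1).
Hypothesis maxM : forall f, ~ M f -> exists g, M (g * f - 1).

Let M0 : M 0. Proof. by case: idM. Qed.
Let MD x y : M x -> M y -> M (x + y). Proof. by case: idM => _ H _; exact: H. Qed.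
Let MM a x : M x -> M (a * x). Proof. by case: idM => _ _ H; exact: H. Qed.
Let MN x : M x -> M (- x). Proof. by rewrite -mulN1r; exact: MM. Qed.

Lemma maximal_ideal_prime f g : M (f * g) -> M f \/ M g.
Proof.
move=> Mfg; have [|nMf] := pselect (M f); [by left|right].
have [h Mh] := maxM nMf.
have -> : g = h * (f * g) - g * (h * f - 1) by ring.
by apply: MD; [exact: MM|apply: MN; exact: MM].
Qed.

Definition at_var (e : 'I_n) (p : {poly K}) : S :=
  (map_poly (@mpolyC n K) p).['X_e].

HB.instance Definition _ e :=
  GRing.RMorphism.copy (at_var e)
    (horner_eval ('X_e : S) \o map_poly (@mpolyC n K)).

Lemma at_varXsubC e x : at_var e ('X - x%:P) = 'X_e - x%:MP.
Proof.
by rewrite rmorphB /= /at_var map_polyX hornerX map_polyC hornerC.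
Qed.

Lemma root_in_maximal e (Q : {poly K}) : Q != 0 -> M (at_var e Q) ->
  exists x, M ('X_e - x%:MP).
Proof.
move=> Q0; have [r ->] := closed_field_poly_normal Q.
rewrite -mul_polyC rmorphM /= => /maximal_ideal_prime[].
  rewrite /at_var map_polyC hornerC /= => Mc; case: M1.
  have -> : 1 = ((lead_coef Q)^-1)%:MP * (lead_coef Q)%:MP :> S.
    by rewrite -mpolyCM mulVf ?lead_coef_eq0.
  exact: MM.
rewrite rmorph_prod; elim: r => [|x r IH]; first by rewrite big_nil => /M1.
rewrite big_cons /= => /maximal_ideal_prime[|//].
by rewrite at_varXsubC => Mx; exists x.
Qed.

(* If no 'X_e - x lies in M, infinitely many inverses of the 'X_e - x modulo M
   have the same size, hence are linearly dependent; clearing denominators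
   gives a polynomial in 'X_e alone in M. *)
Lemma maximal_ideal_point e : exists x, M ('X_e - x%:MP).
Proof.
apply: contrapT => /forallNP nM.
have [g gP] := choice (fun x => maxM (nM x)).
have [k kP] := infinite_fibre (fun x => msize (g x)).
(* There are D monomials of degree below k, so any D + 1 inverses of size k are linearly
   dependent. *)
pose D := #|{: 'X_{1..n < k}}|.
have tuples d : exists t : seq K,
    [/\ size t = d, uniq t & forall x, x \in t -> msize (g x) = k].
  elim: d => [|d [t [st ut tk]]]; first by exists [::].
  have [x xt xk] := kP t; exists (x :: t); split; rewrite /= ?st ?xt //.
  by move=> y; rewrite inE => /orP[/eqP->|/tk].
have [t [st ut tk]] := tuples D.+1.
pose T (i : 'I_D.+1) := t`_i.
have Tin i : T i \in t by rewrite mem_nth ?st.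
have Tinj i j : i != j -> T i != T j.
  by move=> ij; rewrite nth_uniq ?st.
pose A := \matrix_(i < D.+1, j < D) (g (T i))@_(val (enum_val j)).
have : kermx A != 0.
  rewrite kermx_eq0 /row_free neq_ltn; apply/orP; left.
  exact: leq_ltn_trans (rank_leq_col A) (ltnSn _).
case/rowV0Pn => v /sub_kermxP vA v0.
have vg : \sum_i v 0 i *: g (T i) = 0.
  apply/mpolyP => m; rewrite mcoeff0 raddf_sum /=.
  have [mk|km] := ltnP (mdeg m) k.
    have := congr1 (fun X : 'rV__ => X 0 (enum_rank (BMultinom mk))) vA.
    rewrite !mxE => E; rewrite -[RHS]E; apply: eq_bigr => i _.
    by rewrite mcoeffZ mxE enum_rankK.
  apply: big1 => i _; rewrite mcoeffZ memN_msupp_eq0 ?mulr0 //.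
  by apply: msize_mdeg_ge; rewrite tk.
have [j vj] : exists j, v 0 j != 0 by apply/rV0Pn.
pose W i := \prod_(l | l != i) ('X - (T l)%:P : {poly K}).
pose Q := \sum_i (v 0 i)%:P * W i.
have Q0 : Q != 0.
  suff : Q.[T j] != 0 by apply: contra_neq => ->; rewrite horner0.
  rewrite /Q horner_sum (bigD1 j) //= hornerM hornerC big1 ?addr0.
    rewrite mulf_neq0 // /W horner_prod; apply/prodf_neq0 => l lj.
    by rewrite hornerXsubC subr_eq0 Tinj // eq_sym.
  move=> i ij; rewrite hornerM /W (bigD1 j) 1?eq_sym //= hornerM hornerXsubC.
  by rewrite subrr mul0r mulr0.
have /(root_in_maximal Q0)[x /nM//] : M (at_var e Q).
have -> : at_var e Q = \sum_i - ((v 0 i)%:MP * at_var e (W i)) *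
    (g (T i) * ('X_e - (T i)%:MP) - 1).
  rewrite rmorph_sum /=.
  (* Modulo M, [g (T i)] inverts ['X_e - (T i)%:MP], so Q at ['X_e] is congruent to the product of
     all these linear factors times the vanishing combination of the inverses. *)
  transitivity (\sum_i (- ((v 0 i)%:MP * at_var e (W i)) *
    (g (T i) * ('X_e - (T i)%:MP) - 1) +
    at_var e (\prod_l ('X - (T l)%:P)) * (v 0 i *: g (T i)))).
    apply: eq_bigr => i _; rewrite rmorphM (bigD1 i) //= rmorphM /= at_varXsubC.
    rewrite -/(W i) -mul_mpolyC {1}/at_var map_polyC hornerC /=; ring.
  by rewrite big_split /= -mulr_sumr vg mulr0 addr0.
by apply: is_ideal_sum => // i; apply: MM; exact: gP.
Qed.

End MaximalIdeal.

(** A maximal ideal above I contains every ['X_e - (v e)%:MP], hence every g - g(v). A member f of I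
    with f(v) nonzero would put a nonzero constant in it. *)
Theorem weak_nullstellensatz (I : set S) : is_ideal I -> ~ I 1 ->
  exists v : 'I_n -> K, forall f, I f -> f.@[v] = 0.
Proof.
move=> idI I1; have [M [idM IM M1 maxM]] := maximal_ideal_exists idI I1.
have [v vP] := choice (maximal_ideal_point idM M1 maxM).
exists v => f /IM Mf; apply: contrapT => /eqP fv0; apply: M1.
have [M0 MD MM] := idM.
have dM g : M (g - (g.@[v])%:MP).
  have -> : g - (g.@[v])%:MP =
      \sum_(m <- msupp g) (g@_m)%:MP * ('X_[m] - ('X_[m] : S).@[v]%:MP).
    rewrite mevalE rmorph_sum /= {1}[g]mpolyE -sumrB; apply: eq_bigr => m _.
    by rewrite mevalX mpolyCM -mul_mpolyC mulrBr.
  apply: is_ideal_sum => // m; apply: (MM).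
  rewrite mpolyXE_id rmorph_prod rmorph_prod.
  have H (r : seq 'I_n) : M (\prod_(i <- r) 'X_i ^+ m i
      - \prod_(i <- r) (('X_i ^+ m i : S).@[v])%:MP).
    elim: r => [|i r IH]; first by rewrite !big_nil subrr.
    rewrite !big_cons; set a := \prod_(j <- r) _ in IH *.
    set b := \prod_(j <- r) _ in IH *; rewrite rmorphXn /= mevalXU rmorphXn /=.
    have -> : 'X_i ^+ m i * a - (v i)%:MP ^+ m i * b =
      'X_i ^+ m i * (a - b) + b * ('X_i ^+ m i - (v i)%:MP ^+ m i) by ring.
    apply: (MD); first exact: (MM).
    by apply: (MM); rewrite subrXX mulrC; apply: (MM).
  exact: H.
have -> : 1 = ((f.@[v])^-1)%:MP * (f + -1 * (f - (f.@[v])%:MP)) :> S.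
  by rewrite mulN1r opprB addrC subrK -mpolyCM mulVf.
by apply: (MM); apply: (MD) => //; apply: (MM).
Qed.

End Nullstellensatz.

(** * Closed points of the weighted projective plane *)

Section IdealPowers.
Variable S : comNzRingType.
Local Open Scope classical_set_scope.
Implicit Types (I : set S) (k : nat).

Lemma ideal_powD I k x y :
  ideal_pow I k x -> ideal_pow I k y -> ideal_pow I k (x + y).
Proof.
case: k => [//|k] [N [g [h [Ig Ih ->]]]] [N' [g' [h' [Ig' Ih' ->]]]].
pose G T (u : 'I_N -> T) (u' : 'I_N' -> T) i :=
  match split i with inl j => u j | inr j => u' j end.
exists (N + N')%N, (G S g g'), (G S h h'); split.
- by move=> i; rewrite /G; case: split.
- by move=> i; rewrite /G; case: split.
rewrite big_split_ord /=; congr (_ + _); apply: eq_bigr => i _.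
  by rewrite /G (unsplitK (inl i)).
by rewrite /G (unsplitK (inr i)).
Qed.

Lemma ideal_powMl I k a x : ideal_pow I k x -> ideal_pow I k (a * x).
Proof.
elim: k a x => [//|k IH] a x [N [g [h [Ig Ih ->]]]].
exists N, g, (fun i => a * h i); split=> // [i|]; first by apply: IH; exact: Ih.
by rewrite mulr_sumr; apply: eq_bigr => i _; rewrite mulrCA.
Qed.

Lemma ideal_pow0 I k : I 0 -> ideal_pow I k 0.
Proof.
case: k => [//|k] I0; exists 0%N, (fun=> 0), (fun=> 0).
by split=> [i|[]|] //; rewrite big_ord0.
Qed.

Lemma ideal_powM I k g h : I g -> ideal_pow I k h -> ideal_pow I k.+1 (g * h).
Proof.
by move=> Ig Ih; exists 1%N, (fun=> g), (fun=> h); rewrite big_ord1.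
Qed.

Lemma ideal_powX I k i x y : I x -> ideal_pow I (k - i) y ->
  ideal_pow I k (x ^+ i * y).
Proof.
move=> Ix; elim: i k => [|i IH] k; first by rewrite subn0 expr0 mul1r.
case: k => [//|k]; rewrite subSS exprS -mulrA => /IH ?; exact: ideal_powM.
Qed.

Lemma ideal_pow_prod I k (T : Type) (r : seq T) (h : T -> S) (p : T -> nat) y :
  (forall e, I (h e)) -> ideal_pow I (k - \sum_(e <- r) p e) y ->
  ideal_pow I k (\prod_(e <- r) h e ^+ p e * y).
Proof.
move=> Ih; elim: r k => [|e r IH] k; first by rewrite !big_nil subn0 mul1r.
by rewrite !big_cons subnDA -mulrA => /IH; exact: ideal_powX.
Qed.

End IdealPowers.

Lemma ideal_pow_multiplicity n (R : comNzRingType) (I : set {mpoly R[n]})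
    (v : 'I_n -> R) k f :
  (forall g, I g -> g.@[v] = 0) -> ideal_pow I k f -> multiplicity_ge k v f.
Proof.
move=> Iv; elim: k f => [f _ p //|k IH f [N [g [h [Ig Ih ->]]]]].
rewrite /multiplicity_ge rmorph_sum; elim/big_ind: _ => [p _|x y|i _].
- exact: mcoeff0.
- exact: low_orderD.
rewrite rmorphM -add1n; apply: low_orderM; last by apply: IH; exact: Ih.
move=> p; rewrite ltnS leqn0 mdeg_eq0 => /eqP ->.
by rewrite translate0 Iv.
Qed.

Section WeightedOrbits.
Variables (K : fieldType) (a b c : nat).
Hypotheses (a_gt0 : (0 < a)%N) (b_gt0 : (0 < b)%N) (c_gt0 : (0 < c)%N).
Local Open Scope classical_set_scope.

Local Notation S := {mpoly K[3]}.
Local Notation wd := (wdeg a b c).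
Definition weight (e : 'I_3) : nat := wd U_(e)%MM.

Lemma weightE (e : 'I_3) : weight e = nth 0%N [:: a; b; c] e.
Proof.
by case: e => [[|[|[|//]]] he]; rewrite /weight /wdeg !mnm1E /= !(muln0, muln1, addn0).
Qed.

Lemma weight_gt0 e : (0 < weight e)%N.
Proof. by rewrite weightE; case: e => [[|[|[|//]]] he]. Qed.

(* The restriction of f to the orbit (t^a v_0, t^b v_1, t^c v_2). *)
Definition on_orbit (v : 'I_3 -> K) (f : S) : {poly K} :=
  map_poly (meval v) (grade wd f).

HB.instance Definition _ v :=
  GRing.RMorphism.copy (on_orbit v) (map_poly (meval v) \o @grade 3 K wd).

Lemma coef_on_orbit v f d : (on_orbit v f)`_d = (pihomog wd d f).@[v].
Proof. by rewrite coef_map coef_grade. Qed.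

Lemma horner_on_orbit v f t :
  (on_orbit v f).[t] = f.@[fun e => v e * t ^+ weight e].
Proof.
have H : horner_eval t \o on_orbit v =1 meval (fun e => v e * t ^+ weight e).
  apply: (rmorph_mpolyP (u := horner_eval t \o on_orbit v)
    (u' := meval (fun e => v e * t ^+ weight e))) => [x|e] /=.
    by rewrite /on_orbit /grade mmapC /= map_polyC /horner_eval hornerC /= !mevalC.
  rewrite /on_orbit /grade mmapX mmap1U mevalXU rmorphM /= map_polyC /=.
  by rewrite map_polyXn /horner_eval hornerM hornerC hornerXn mevalXU.
exact: H.
Qed.

(** The homogeneous ideal of the weighted point v, written as the kernel of a morphism into a
    domain, which makes it prime. *)
Definition orbit_ideal (v : 'I_3 -> K) : set S := [set f | on_orbit v f = 0].

Lemma orbit_idealE v f :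
  orbit_ideal v f <-> forall d, (pihomog wd d f).@[v] = 0.
Proof.
split=> [f0 d|H]; first by rewrite -coef_on_orbit f0 coef0.
by apply/polyP => d; rewrite coef_on_orbit H coef0.
Qed.

Lemma on_orbitX v e : on_orbit v 'X_e = v e *: 'X^(weight e).
Proof.
rewrite /on_orbit /grade mmapX mmap1U rmorphM /= map_polyC /= map_polyXn.
by rewrite mevalXU mul_polyC.
Qed.

Lemma orbit_ideal_prime v : prime_ideal (orbit_ideal v).
Proof.
have inI f : (f \in mem (orbit_ideal v)) = (on_orbit v f == 0).
  by apply/idP/eqP => [|f0]; rewrite inE.
split; [split=> [||x f g]|move=> f g]; rewrite ?inI.
- by rewrite rmorph0.
- by rewrite rmorph1 oner_neq0.
- by move=> /eqP f0 /eqP g0; rewrite rmorphD rmorphM /= f0 g0 mulr0 addr0.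
- by rewrite rmorphM mulf_eq0.
Qed.

End WeightedOrbits.

Section WeightedPoints.
Variables (R : realType) (a b c : nat).
Hypotheses (a_gt0 : (0 < a)%N) (b_gt0 : (0 < b)%N) (c_gt0 : (0 < c)%N).
Local Open Scope classical_set_scope.

Local Notation K := R[i].
Local Notation S := {mpoly R[i][3]}.
Local Notation wd := (wdeg a b c).
Local Notation orbit_ideal := (@orbit_ideal K a b c).
Local Notation weight_gt0 := (weight_gt0 a_gt0 b_gt0 c_gt0).

Lemma orbit_ideal_homog (v : 'I_3 -> K) : homog_ideal a b c (orbit_ideal v).
Proof.
move=> f /orbit_idealE f0 d; apply/orbit_idealE => e.
have [->|ne] := eqVneq d e; first by rewrite pihomog_id f0.
by rewrite (pihomog_ne0 ne (pihomogP _ _ _)) meval0.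
Qed.

Lemma orbit_ideal_relevant (v : 'I_3 -> K) : v 0 != 0 ->
  ~ @irrelevant_ideal R a b c `<=` orbit_ideal v.
Proof.
move=> v0 /(_ 'X_0); rewrite /irrelevant_ideal /orbit_ideal /= on_orbitX.
rewrite pihomogX -/(weight a b c 0) (gtn_eqF (weight_gt0 0)) => /(_ erefl)/eqP.
by rewrite scaler_eq0 (negbTE v0) /= -size_poly_eq0 size_polyXn.
Qed.

Definition orbit_point v (v0 : v 0 != 0) : proj R a b c :=
  Proj (orbit_ideal_prime a b c v) (@orbit_ideal_homog v) (orbit_ideal_relevant v0).

(** The slice h = 1 meets the cone of P. If 1 - g (h - 1) were in P, comparing components would give
    g_(jD) = -h^j modulo P for all j; for large j the left side is 0, so h^j and then h would lie in
    P. *)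
Lemma homog_prime_unit_level (P : proj R a b c) h D (g : S) :
  (0 < D)%N -> h \is D.-homog for wd -> ~ proj_ideal P h ->
  ~ proj_ideal P (1 - g * (h - 1)).
Proof.
move=> D0 hD nPh H; have [P0 PD PM] := prime_ideal_is_ideal (proj_prime P).
pose q := 1 - g * (h - 1).
have comp i : pihomog wd i g = pihomog wd i q - pihomog wd i 1
    + pihomog wd i (h * g).
  rewrite -raddfB -raddfD; congr (pihomog _ _ _). by rewrite /q; ring.
have Pq i : proj_ideal P (pihomog wd i q) by exact: proj_homog.
have hg0 : pihomog wd 0 (h * g) = 0.
  rewrite -coef_grade rmorphM /= (grade_homog hD) -mul_polyC -mulrA coefCM.
  by rewrite coefXnM D0 mulr0.
have h1 : pihomog wd 0 (1 : S) = 1 by rewrite pihomog_dE ?dhomog1.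
have step j : proj_ideal P (pihomog wd (j * D) g + h ^+ j).
  elim: j => [|j IH].
    by rewrite mul0n comp hg0 addr0 expr0 h1 subrK.
  rewrite mulSn comp (pihomog_mull _ _ hD) exprS.
  rewrite (@pihomog_ne0 _ _ wd 0 _ 1) ?dhomog1 //;
    last by rewrite neq_ltn addn_gt0 D0.
  by rewrite subr0 -addrA -mulrDr; apply: PD; [exact: Pq|exact: PM].
pose j := mmeasure wd g.
have : proj_ideal P (h ^+ j).
  have := step j; rewrite (_ : pihomog wd (j * D) g = 0) ?add0r //.
  rewrite pihomogE big_seq_cond big1 // => m /andP[mg /eqP E].
  have : (j * D < j)%N by rewrite -E; exact: mmeasure_mnm_lt.
  by rewrite ltnNge leq_pmulr.
by move/(prime_ideal_exp (proj_prime P)).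
Qed.

(** The Nullstellensatz applied to the proper ideal P + (xyz - 1) gives v with nonzero coordinates.
    As P is homogeneous, it lies in the ideal of the orbit of v; as P is closed, the two are
    equal. *)
Lemma closed_point_vector (P : proj R a b c) : closed_point P ->
  ~ proj_ideal P ('X_0 * 'X_1 * 'X_2) ->
  exists v : 'I_3 -> K, (forall e, v e != 0) /\ proj_ideal P = orbit_ideal v.
Proof.
move=> Pcl nPh; set h : S := 'X_0 * 'X_1 * 'X_2 in nPh.
have [P0 PD PM] := prime_ideal_is_ideal (proj_prime P).
pose J : set S := [set f | exists p g, proj_ideal P p /\ f = p + g * (h - 1)].
have idJ : is_ideal J.
  split; first by exists 0, 0; rewrite mul0r addr0.
    move=> _ _ [p [g [Pp ->]]] [p' [g' [Pp' ->]]]; exists (p + p'), (g + g').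
    by split; [exact: PD|rewrite mulrDl addrACA].
  move=> x _ [p [g [Pp ->]]]; exists (x * p), (x * g).
  by split; [exact: PM|rewrite mulrDr mulrA].
pose hm : 'X_{1..3} := (U_(0%R) + U_(1%R) + U_(2%R))%MM.
have hE : h = 'X_[hm] by rewrite !mpolyXD.
have hD : h \is (wd hm).-homog for wd by rewrite hE dhomogX.
have D0 : (0 < wd hm)%N.
  by rewrite !mfD addn_gt0 (weight_gt0 2) orbT.
have J1 : ~ J 1.
  move=> [p [g [Pp E]]]; apply: (homog_prime_unit_level D0 hD nPh (g := g)).
  by rewrite {1}E addrK.
have [v vP] := weak_nullstellensatz (@complex_infinite_fibre R) idJ J1.
have hv : v 0 * v 1 * v 2 = 1.
  have : (h - 1).@[v] = 0 by apply: vP; exists 0, 1; rewrite mul1r add0r.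
  rewrite rmorphB rmorph1 !rmorphM /= !mevalXU => /eqP.
  by rewrite subr_eq0 => /eqP.
have v_neq0 e : v e != 0.
  have /negP : v 0 * v 1 * v 2 != 0 by rewrite hv oner_neq0.
  rewrite !mulf_eq0; case: e => [[|[|[|//]]] he] H; apply/eqP => v0; apply: H.
  - by rewrite (_ : 0 = Ordinal he) ?v0 ?eqxx //; apply: val_inj.
  - by rewrite (_ : 1 = Ordinal he) ?v0 ?eqxx ?orbT //; apply: val_inj.
  - by rewrite (_ : 2 = Ordinal he) ?v0 ?eqxx ?orbT //; apply: val_inj.
exists v; split=> //.
have PI : proj_ideal P `<=` orbit_point (v_neq0 0).
  move=> f Pf; apply/orbit_idealE => d; apply: vP.
  by exists (pihomog wd d f), 0; rewrite mul0r addr0; split=> //; exact: proj_homog.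
by rewrite -(Pcl _ PI).
Qed.

End WeightedPoints.

Section SymbolicPowersAtPoints.
Variables (K : closedFieldType) (a b c : nat).
Hypotheses (a_gt0 : (0 < a)%N) (co_ab : coprime a b).
Local Open Scope classical_set_scope.

Local Notation S := {mpoly K[3]}.
Local Notation wd := (wdeg a b c).
Local Notation weight := (weight a b c).

Lemma map_mpoly_homog n (A B : comNzRingType) (u : {rmorphism A -> B})
    (mf : measure n) d (F : {mpoly A[n]}) :
  F \is d.-homog for mf -> map_mpoly u F \is d.-homog for mf.
Proof.
move=> /dhomogP Fd; apply/dhomogP => m; rewrite mcoeff_msupp mcoeff_map_mpoly.
move=> uF; apply: Fd; rewrite mcoeff_msupp.
by apply: contra_neq uF => ->; rewrite raddf0.
Qed.

Lemma map_tcoef n (A B : comNzRingType) (u : {rmorphism A -> B})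
    (v : 'I_n -> A) p F :
  u (tcoef v p F) = tcoef (u \o v) p (map_mpoly u F).
Proof. by rewrite -!mcoeff_translate -map_translate mcoeff_map_mpoly. Qed.

(** The denominator s does not vanish identically on the orbit, so it is a local unit at some t and
    drops out there. Homogeneity carries the multiplicity back to v; the factor ['X] keeps t away
    from 0. *)
Lemma symbolic_pow_multiplicity (v : 'I_3 -> K) k e (F : S) :
  F \is e.-homog for wd -> symbolic_pow (orbit_ideal a b c v) k F ->
  multiplicity_ge k v F.
Proof.
move=> Fe [s nIs Is]; have s0 : 'X * on_orbit a b c v s != 0.
  by rewrite mulf_neq0 ?polyX_eq0 //; exact/eqP.
have /closed_nonrootP[t] := s0.
rewrite /root hornerM hornerX mulf_eq0 negb_or => /andP[t0].
rewrite horner_on_orbit => st.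
have : multiplicity_ge k (fun e => v e * t ^+ weight e) (s * F).
  apply: ideal_pow_multiplicity Is => g gI.
  by rewrite -horner_on_orbit gI horner0.
rewrite {1}/multiplicity_ge rmorphM -[k in low_order k _]add0n.
move=> sF; have H : multiplicity_ge k (fun e => v e * t ^+ weight e) F.
  apply: low_order_cancel sF => //; apply: low_order1N.
  by rewrite translate0.
apply/multiplicity_geE => p pk; move/multiplicity_geE/(_ p pk): H.
rewrite (tcoef_scale v t p Fe) => /eqP.
by rewrite mulf_eq0 expf_eq0 (negbTE t0) andbF orbF => /eqP.
Qed.

(* A monomial fraction x'/y' of degree 1 projects the neighbourhood of v onto
   a slice of degree 0; clearing denominators in the Taylor expansion of F gives
   y'^e F = \sum_p tcoef v p F * x'^(e - deg p) * h^p with h in the ideal. *)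
Lemma multiplicity_symbolic_pow (v : 'I_3 -> K) k e (F : S) :
  (forall i, v i != 0) ->
  F \is e.-homog for wd -> multiplicity_ge k v F ->
  symbolic_pow (orbit_ideal a b c v) k F.
Proof.
move=> v0 Fe /multiplicity_geE Fk.
(* Here a i = 1 + b j, so x' has degree one more than y'. The constant t0 makes both agree at v, so
   that every [h l] vanishes on the orbit. *)
have [j _] := Bezoutl b a_gt0; rewrite (eqP co_ab) => /dvdnP[i aibj].
pose t0 := v 0 ^+ i / v 1 ^+ j.
pose x' : S := 'X_0 ^+ i; pose y' : S := t0 *: 'X_1 ^+ j.
pose h l : S := 'X_l * y' ^+ weight l - (v l)%:MP * x' ^+ weight l.
have t0E : t0 * v 1 ^+ j = v 0 ^+ i by rewrite divfK // expf_neq0.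
have orb := @on_orbitX K a b c v.
have orby : on_orbit a b c v y' = v 0 ^+ i *: 'X^(b * j).
  rewrite /y' -mul_mpolyC rmorphM rmorphXn /= orb.
  rewrite {1}/on_orbit /grade mmapC /= map_polyC /= mevalC -t0E.
  by rewrite exprZn mul_polyC scalerA -exprM weightE.
have orbx : on_orbit a b c v x' = v 0 ^+ i *: 'X^(a * i).
  by rewrite rmorphXn /= orb exprZn -exprM weightE.
have Ih l : orbit_ideal a b c v (h l).
  have orbc x : on_orbit a b c v x%:MP = x%:P.
    by rewrite /on_orbit /grade mmapC /= map_polyC /= mevalC.
  suff : on_orbit a b c v (h l) = 0 by [].
  have -> : on_orbit a b c v (h l) =
      on_orbit a b c v 'X_l * on_orbit a b c v y' ^+ weight l -
      on_orbit a b c v (v l)%:MP * on_orbit a b c v x' ^+ weight l.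
    rewrite /h; move: x' y' {h orbx orby} => x' y'.
    rewrite (rmorphB (on_orbit a b c v)) !(rmorphM (on_orbit a b c v)).
    by rewrite !(rmorphXn (on_orbit a b c v)).
  rewrite orbx orby orb orbc.
  rewrite !exprZn mul_polyC -scalerAl -scalerAr !scalerA -!exprM -exprD.
  suff -> : (weight l + b * j * weight l = a * i * weight l)%N by rewrite subrr.
  by rewrite -mulSn; congr (_ * _)%N; rewrite [RHS]mulnC -aibj; lia.
exists (y' ^+ e).
  rewrite /orbit_ideal /= rmorphXn /= orby => /eqP.
  by rewrite expf_eq0 scaler_eq0 expf_eq0 (negbTE (v0 0)) !andbF /=
    -size_poly_eq0 size_polyXn andbF.
pose F1 := map_mpoly (@mpolyC 3 K) F.
have -> : y' ^+ e * F = F1.@[fun e => h e + (v e)%:MP * x' ^+ weight e].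
  rewrite /F1 /map_mpoly rmorph_mmap /mmap {1}[F]mpolyE mulr_sumr big_seq
    [RHS]big_seq.
  apply: eq_bigr => m mF /=; rewrite mevalC -scalerAr -mul_mpolyC; congr (_ * _).
  rewrite mpolyXE_id; transitivity (\prod_i (('X_i : S) * y' ^+ weight i) ^+ m i).
    rewrite [RHS](eq_bigr (fun l => ('X_l : S) ^+ m l * y' ^+ (m l * weight l))).
      rewrite big_split /= -expr_sum mulrC; congr (_ * _ ^+ _).
      by rewrite -(dhomog_mf Fe mF) [LHS]mfE.
    by move=> l _; rewrite exprMn -exprM [(_ * m l)%N]mulnC.
  by apply: eq_bigr => l _; rewrite /= mevalXU /h subrK.
rewrite -meval_translate mevalE; elim/big_ind: _ => [||p _].
- by apply: ideal_pow0; rewrite /orbit_ideal /= rmorph0.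
- by move=> x y; exact: ideal_powD.
rewrite mcoeff_translate.
rewrite (tcoef_scale (fun e => (v e)%:MP) x' p (map_mpoly_homog _ Fe)).
rewrite -map_tcoef; have [pk|kp] := ltnP (mdeg p) k.
  rewrite Fk // raddf0 !mul0r; apply: ideal_pow0.
  by rewrite /orbit_ideal /= rmorph0.
apply: ideal_powMl; rewrite -[\prod_(_ < _) _]mulr1; apply: ideal_pow_prod => //.
by rewrite -mdegE (eqP kp).
Qed.

End SymbolicPowersAtPoints.

(** * The covering of the weighted plane by the projective plane *)

Lemma low_orderMCX n (R : comNzRingType) (q : 'X_{1..n}) (U : {mpoly R[n]}) p :
  (mdeg p <= mdeg q)%N -> ('X_[q] * U)@_p = U@_0%MM * (q == p)%:R.
Proof.
move=> pq; have -> : 'X_[q] * U = U@_0%MM *: 'X_[q] + 'X_[q] * (U - (U@_0%MM)%:MP).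
  by rewrite mulrBr ['X_[q] * _%:MP]mulrC mul_mpolyC addrC subrK.
rewrite mcoeffD mcoeffZ mcoeffX [X in _ + X](_ : _ = 0) ?addr0 //.
have : low_order (mdeg q + 1) ('X_[q] * (U - (U@_0%MM)%:MP)).
  apply: low_orderM => [r rq|r].
    by rewrite mcoeffX; case: eqP rq => // ->; rewrite ltnn.
  rewrite ltnS leqn0 mdeg_eq0 => /eqP ->.
  by rewrite mcoeffB mcoeffC eqxx mulr1 subrr.
by apply; rewrite addn1 ltnS.
Qed.

(** As u_e(0) is nonzero, the substitution multiplies each coefficient of the lowest form of A by a
    nonzero constant, so it preserves the order. *)
Lemma low_order_comp n (R : idomainType) (u : 'I_n -> {mpoly R[n]}) m
    (A : {mpoly R[n]}) :
  (forall e, (u e)@_0%MM != 0) ->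
  low_order m (mmap (@mpolyC n R) (fun e => 'X_e * u e) A) -> low_order m A.
Proof.
move=> u0 Am; have [->|A0] := eqVneq A 0; first by move=> p _; rewrite mcoeff0.
have [k Ak nAk] := low_order_exists A0; have [mk|km] := leqP m k.
  exact: low_orderW Ak.
case: nAk => p; rewrite ltnS leq_eqVlt => /orP[/eqP pk|/Ak//].
pose U q : {mpoly R[n]} := \prod_e u e ^+ (q : 'X_{1..n}) e.
have := Am p; rewrite pk => /(_ km); rewrite /mmap raddf_sum /=.
have E q : q \in msupp A ->
    ((A@_q)%:MP * mmap1 (fun e => 'X_e * u e) q)@_p
      = A@_q * ((U q)@_0%MM * (q == p)%:R).
  move=> qA; rewrite mcoeffCM; congr (_ * _).
  have -> : mmap1 (fun e => 'X_e * u e) q = 'X_[q] * U q.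
    rewrite mpolyXE_id /U -big_split; apply: eq_bigr => e _.
    by rewrite exprMn.
  apply: low_orderMCX; rewrite pk leqNgt; apply: contraL qA => qk.
  by rewrite mcoeff_msupp Ak ?eqxx.
have [pA|/memN_msupp_eq0//] := boolP (p \in msupp A).
rewrite big_seq (eq_bigr _ E) -big_seq (bigD1_seq p) ?msupp_uniq //= big1.
  rewrite eqxx addr0 mulr1 => /eqP; rewrite mulf_eq0 => /orP[/eqP//|].
  rewrite /U rmorph_prod prodf_seq_eq0 => /hasP[e _] /=.
  by rewrite rmorphXn expf_eq0 (negbTE (u0 e)) andbF.
by move=> q /negbTE ->; rewrite !mulr0.
Qed.

Section PowerCover.
Variables (K : numFieldType) (n : nat) (mf : measure n).
Variable zeta nu : 'I_n -> K.
Local Notation w e := (mf U_(e)%MM).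
Hypothesis w_gt0 : forall e, (0 < w e)%N.
Hypothesis zeta_prim : forall e, (w e).-primitive_root (zeta e).
Hypothesis nu_neq0 : forall e, nu e != 0.

(** The sum runs over a multiple N of the order of the root, so that a single N serves all
    coordinates. *)
Lemma unity_sum e (N k : nat) : (w e %| N)%N ->
  \sum_(j < N) (zeta e ^+ j) ^+ k = (if (w e %| k)%N then N else 0)%:R.
Proof.
move=> wN; rewrite (eq_bigr (fun j : 'I_N => (zeta e ^+ k) ^+ j)); last first.
  by move=> j _; rewrite -!exprM mulnC.
rewrite (prim_order_dvd (zeta_prim e)); case: eqP => [->|/eqP zk].
  by rewrite (eq_bigr (fun=> 1)) ?sumr_const ?card_ord // => j _; rewrite expr1n.
have : (zeta e ^+ k - 1) * \sum_(j < N) (zeta e ^+ k) ^+ j = 0.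
  rewrite -subrX1 -exprM mulnC exprM.
  have /eqP -> : zeta e ^+ N == 1 by rewrite -(prim_order_dvd (zeta_prim e)).
  by rewrite expr1n subrr.
by move/eqP; rewrite mulf_eq0 subr_eq0 (negbTE zk) => /eqP.
Qed.

Variables (m : nat) (f : {mpoly K[n]}).
Hypothesis f_mult : forall j : 'I_n -> nat,
  multiplicity_ge m (fun e => nu e * zeta e ^+ j e) f.

Variable rho : 'X_{1..n}.
Let congr_rho (g : 'X_{1..n}) := [forall e, (g e == rho e %[mod w e])%N].

Definition isotypic : {mpoly K[n]} :=
  \sum_(g <- msupp f | congr_rho g) f@_g *: 'X_[g].

Lemma isotypic_coef g : isotypic@_g = if congr_rho g then f@_g else 0.
Proof.
rewrite /isotypic raddf_sum /=.
rewrite (eq_bigr (fun g' => if g' == g then f@_g else 0)); last first.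
  by move=> g' _; rewrite mcoeffZ mcoeffX; case: eqP => [->|]; rewrite ?mulr1 ?mulr0.
rewrite -big_mkcondr /= big_const_seq iter_addr_0.
have [gf|gf] := boolP (g \in msupp f); last first.
  by rewrite (memN_msupp_eq0 gf) mul0rn; case: ifP.
case: ifP => cg.
  rewrite (@eq_count _ _ (pred1 g)) ?count_uniq_mem ?msupp_uniq ?gf //.
  by move=> h /=; case: eqP => [->|]; rewrite ?andbF ?cg.
rewrite (@eq_count _ _ pred0) ?count_pred0 //.
by move=> h /=; case: eqP => [->|]; rewrite ?andbF ?cg.
Qed.

(* Averaging f over the group of the covering, which permutes the points. *)
Lemma isotypic_multiplicity : multiplicity_ge m nu isotypic.
Proof.
apply/multiplicity_geE => p pm.
pose N := (\prod_e w e)%N.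
have wN e : (w e %| N)%N by rewrite /N (bigD1 e) //= dvdn_mulr.
have N0 : (0 < N)%N by apply: prodn_gt0.
pose T g : K := \prod_i (nu i ^+ (g i - p i) *+ 'C(g i, p i)).
have sub : {subset msupp isotypic <= msupp f}.
  by move=> g; rewrite !mcoeff_msupp isotypic_coef; case: ifP => // _; rewrite eqxx.
(* Since w e divides N, the exponent is p e - rho e modulo w e: p cancels the shift in the divided
   derivative, and (N - 1) rho selects the class of rho without subtraction. *)
have E : \sum_(F : {ffun 'I_n -> 'I_N})
    \prod_e (zeta e ^+ F e) ^+ (p e + (N - 1) * rho e)
      * tcoef (fun e => nu e * zeta e ^+ F e) p f
    = (N ^ n)%:R * tcoef nu p isotypic.
  rewrite (tcoefE _ _ (msupp_uniq f) sub) mulr_sumr.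
  under eq_bigr do rewrite mulr_sumr.
  rewrite exchange_big /=; apply: eq_bigr => g _.
  rewrite isotypic_coef -/(T g).
  have -> : (N ^ n)%:R * ((if congr_rho g then f@_g else 0) * T g) =
    f@_g * T g * \prod_e \sum_(j < N) (zeta e ^+ j) ^+ (g e + (N - 1) * rho e).
    under eq_bigr do rewrite unity_sum //.
    case: ifP => [/forallP cg|ncg].
      rewrite (eq_bigr (fun=> N%:R)) => [|e _].
        by rewrite prodr_const card_ord natrX mulrC.
      suff -> : (w e %| g e + (N - 1) * rho e)%N by [].
      rewrite /dvdn -modnDml (eqP (cg e)) modnDml -mulSn subn1 prednK //.
      by rewrite -/(dvdn _ _) dvdn_mulr.
    have /negbT := ncg; rewrite negb_forall => /existsP[e ne].
    rewrite mul0r mulr0 (bigD1 e) //= ifN ?mul0r ?mulr0 //.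
    apply: contra ne => /eqP dv; apply/eqP.
    have H : (g e + (N - 1) * rho e + rho e = rho e %[mod w e])%N.
      by rewrite -modnDml dv add0n.
    rewrite -H -addnA addnC -mulSnr subn1 prednK //.
    by rewrite -modnDml; have /eqP -> := dvdn_mulr (rho e) (wN e).
  rewrite bigA_distr_bigA mulr_sumr; apply: eq_bigr => F _.
  rewrite mulrCA -!mulrA; congr (_ * _); rewrite /T -!big_split /=.
  apply: eq_bigr => e _; have [pg|gp] := leqP (p e) (g e); last first.
    by rewrite bin_small // !mulr0n !(mul0r, mulr0).
  rewrite exprMn !mulrnAl mulrnAr; congr (_ *+ _); rewrite mulrCA.
  by congr (_ * _); rewrite -exprD; congr (_ ^+ _); lia.
have NK : (N ^ n)%:R != 0 :> K by rewrite pnatr_eq0 -lt0n expn_gt0 N0.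
apply: (mulfI NK); rewrite -E mulr0; apply: big1 => F _.
have /multiplicity_geE -> // := f_mult (fun e => F e).
by rewrite mulr0.
Qed.

Hypothesis rho_lt : forall e, (rho e < w e)%N.

Definition descent : {mpoly K[n]} :=
  \sum_(g <- msupp f | congr_rho g) f@_g *: 'X_[[multinom (g e %/ w e)%N | e < n]].

Lemma isotypicE :
  isotypic = 'X_[rho] * mmap (@mpolyC n K) (fun e => 'X_e ^+ w e) descent.
Proof.
rewrite /isotypic /descent rmorph_sum mulr_sumr; apply: eq_bigr => g cg.
rewrite /= mmapZ mmapX mul_mpolyC -scalerAr; congr (_ *: _).
rewrite [X in _ * X](_ : _ = 'X_[[multinom (g e %/ w e * w e)%N | e < n]]).
  rewrite -mpolyXD; congr 'X_[_]; apply/mnmP => e; rewrite mnmDE mnmE.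
  have := forallP cg e; rewrite (modn_small (rho_lt e)) => /eqP <-.
  by rewrite addnC -divn_eq.
rewrite mpolyXE_id; apply: eq_bigr => e _.
by rewrite !mnmE -exprM mulnC.
Qed.

Lemma descent_homog d :
  f \is d.-homog -> descent \is (d - mdeg rho).-homog for mf.
Proof.
move=> f_homog.
rewrite /descent big_seq_cond; apply: rpred_sum => g /andP[gf cg].
apply: dhomogZ; rewrite dhomogX mfE; apply/eqP.
have <- : mdeg g = d := dhomog_mf f_homog gf.
rewrite !mdegE -sumnB => [|e _].
  apply: eq_bigr => e _; rewrite mnmE.
  have := forallP cg e; rewrite (modn_small (rho_lt e)) => /eqP <-.
  by rewrite {2}(divn_eq (g e) (w e)) addnK.
by have := forallP cg e; rewrite (modn_small (rho_lt e)) => /eqP <-; exact: leq_mod.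
Qed.

Lemma descent_multiplicity : multiplicity_ge m (fun e => nu e ^+ w e) descent.
Proof.
have := isotypic_multiplicity; rewrite isotypicE /multiplicity_ge rmorphM /=.
rewrite -[m in low_order m _]add0n => H.
have {}H : low_order m (translate nu
    (mmap (@mpolyC n K) (fun e => 'X_e ^+ w e) descent)).
  apply: low_order_cancel H => //; apply: low_order1N.
  rewrite translate0 mevalX; apply/prodf_neq0 => e _.
  by rewrite expf_neq0.
(* The difference of w-th powers of X_e + nu_e and nu_e is X_e u_e, and u_e has constant term w
   nu_e^(w-1), nonzero in characteristic 0: the covering is a local isomorphism at nu. *)
pose u e : {mpoly K[n]} :=
  \sum_(i < w e) ('X_e + (nu e)%:MP) ^+ ((w e).-1 - i) * (nu e)%:MP ^+ i.
apply: (@low_order_comp _ _ u) => [e|].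
  rewrite raddf_sum /= (eq_bigr (fun=> nu e ^+ (w e).-1)) => [|i _].
    rewrite sumr_const card_ord -mulr_natl mulf_neq0 ?expf_neq0 //.
    by rewrite pnatr_eq0 -lt0n.
  rewrite rmorphM !rmorphXn rmorphD /= mcoeffX mcoeffC eqxx mulr1.
  rewrite mnm1_eq0 add0r -exprD; congr (_ ^+ _).
  by have := ltn_ord i; lia.
rewrite (_ : mmap _ _ _ = translate nu
    (mmap (@mpolyC n K) (fun e => 'X_e ^+ w e) descent)) //.
rewrite /translate !rmorph_mmap; apply: eq_mmap => [x|e] /=.
  by rewrite !mmapC.
rewrite rmorphD /= !rmorphXn /= !mmapX !mmap1U mmapC.
have := subrXX ('X_e + (nu e)%:MP) (nu e)%:MP (w e).
by rewrite addrK -/(u e) => <-; rewrite subrK.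
Qed.

End PowerCover.

(** * Orders along prime divisors *)

Section OrderAlong.
Variables (K : closedFieldType) (a b c : nat).
Hypotheses (a_gt0 : (0 < a)%N) (co_ab : coprime a b).
Local Open Scope classical_set_scope.
Local Notation S := {mpoly K[3]}.
Local Notation wd := (wdeg a b c).

(** Membership in symbolic powers is only tested on forms: the multiplicity at a single vector says
    nothing about the rest of the orbit for other polynomials. *)
Definition order_along (I : set S) (val : S -> nat) : Prop :=
  (forall F e k, F != 0 -> F \is e.-homog for wd ->
    symbolic_pow I k F <-> (k <= val F)%N) /\
  (forall F G, F != 0 -> G != 0 -> val (F * G) = (val F + val G)%N).

Lemma orbit_order (v : 'I_3 -> K) : (forall e, v e != 0) ->
  exists val, order_along (orbit_ideal a b c v) val.
Proof.
move=> v0; have ex (F : S) : exists k, F != 0 ->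
    low_order k (translate v F) /\ ~ low_order k.+1 (translate v F).
  have [->|F0] := eqVneq F 0; first by exists 0%N.
  have /low_order_exists[k Fk nFk] : translate v F != 0 by rewrite translate_eq0.
  by exists k.
have [val valP] := choice ex; exists val; split=> [F e k F0 Fe|F G F0 G0].
  have [Fv nFv] := valP F F0; split=> [sk|kv].
    have := symbolic_pow_multiplicity Fe sk; rewrite leqNgt => Fk.
    by apply/negP => vk; apply: nFv; exact: low_orderW Fk.
  by apply: (multiplicity_symbolic_pow a_gt0 co_ab v0 Fe); exact: low_orderW Fv.
have FG0 : F * G != 0 by rewrite mulf_neq0.
have [Fv nFv] := valP F F0; have [Gv nGv] := valP G G0.
have [FGv nFGv] := valP _ FG0; apply/eqP; rewrite eqn_leq; apply/andP; split.
  rewrite leqNgt; apply/negP => lt; apply: nGv.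
  apply: (low_order_strict Fv nFv Gv); rewrite -rmorphM.
  exact: low_orderW FGv.
rewrite leqNgt; apply/negP => lt; apply: nFGv; rewrite rmorphM.
exact: low_orderW lt (low_orderM Fv Gv).
Qed.

Lemma principal_pow (p : S) (I : set S) k f :
  (forall g, I g <-> divides p g) -> ideal_pow I k f <-> divides (p ^+ k) f.
Proof.
move=> Ip; elim: k f => [|k IH] f.
  by split=> // _; exists f; rewrite expr0 mulr1.
split=> [[N [g [h [Ig Ih ->]]]]|[q ->]].
  elim/big_ind: _ => [|x y [q ->] [r ->]|i _]; first by exists 0; rewrite mul0r.
    by exists (q + r); rewrite mulrDl.
  have [q ->] := (Ip _).1 (Ig i); have [r ->] := (IH _).1 (Ih i).
  by exists (q * r); rewrite exprS mulrACA.
rewrite exprS mulrCA; apply: ideal_powM; first by apply/Ip; exists 1; rewrite mul1r.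
by apply/IH; exists q.
Qed.

Lemma prime_power_part (p F : S) : prime_element p -> F != 0 ->
  exists k G, F = p ^+ k * G /\ ~ divides p G.
Proof.
move=> pp; have [p0 pu pP] := pp.
have [n] := ubnP (msize F); elim: n F => // n IH F Fn F0.
have [[G FE]|npF] := pselect (divides p F); last first.
  by exists 0%N, F; rewrite expr0 mul1r.
have G0 : G != 0 by apply: contra_neq F0 => G0; rewrite FE G0 mul0r.
have sp : (1 < msize p)%N.
  rewrite ltnNge; apply: contra pu => /msize1_polyC pE; rewrite pE.
  apply: rmorph_unit; rewrite unitfE; apply: contra_neq p0 => p00.
  by rewrite pE p00 mpolyC0.
have [|//|k [H [GE nH]]] := IH G.
  move: Fn; rewrite FE msizeM // => Fn.
  have aux x y : (1 < y -> (x + y).-1 < n.+1 -> x < n)%N by lia.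
  exact: aux sp Fn.
by exists k.+1, H; split; rewrite // FE GE exprSr -!mulrA [H * p]mulrC.
Qed.

Lemma principal_order (p : S) (I : set S) : prime_element p ->
  (forall g, I g <-> divides p g) -> exists val, order_along I val.
Proof.
move=> pp Ip; have [p0 pu pP] := pp.
have ex (F : S) : exists k, F != 0 -> exists2 G, F = p ^+ k * G & ~ divides p G.
  have [->|F0] := eqVneq F 0; first by exists 0%N.
  by have [k [G [FE nG]]] := prime_power_part pp F0; exists k => _; exists G.
have [val valP] := choice ex; exists val.
have expI k l (G H : S) : ~ divides p G -> ~ divides p H ->
    p ^+ k * G = p ^+ l * H -> (k <= l)%N.
  move=> nG nH E; rewrite leqNgt; apply/negP => lk; apply: nH.
  exists (p ^+ (k - l).-1 * G); apply: (mulfI (expf_neq0 l p0)); rewrite -E.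
  have -> : k = (l + (k - l).-1.+1)%N by lia.
  by rewrite exprD exprS addKn /=; ring.
split=> [F e k F0 Fe|F G F0 G0].
  have [G FE nG] := valP F F0; split=> [[s nIs]|kv].
    move=> /(principal_pow _ _ Ip)[q sF].
    have ns : ~ divides p s by move/Ip.
    have nsG : ~ divides p (s * G) by case/pP.
    rewrite leqNgt; apply/negP => vk; apply: nsG.
    exists (q * p ^+ (k - val F).-1); apply: (mulfI (expf_neq0 (val F) p0)).
    rewrite mulrCA -FE sF; have {1}-> : k = (val F + (k - val F).-1.+1)%N by lia.
    by rewrite exprD exprS; ring.
  exists 1; first by move/Ip/(unit_dividesN pp (unitr1 _)).
  apply/(principal_pow _ _ Ip); exists (p ^+ (val F - k) * G).
  by rewrite mul1r {1}FE -{1}(subnKC kv) exprD; ring.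
have [F' FE nF] := valP F F0; have [G' GE nG] := valP G G0.
have [H HE nH] := valP _ (mulf_neq0 F0 G0).
have nFG : ~ divides p (F' * G') by case/pP.
have E : p ^+ val (F * G) * H = p ^+ (val F + val G) * (F' * G').
  by rewrite -HE {1}FE {1}GE exprD mulrACA.
by apply/eqP; rewrite eqn_leq (expI _ _ _ _ nH nFG E) (expI _ _ _ _ nFG nH (esym E)).
Qed.

End OrderAlong.

Lemma prime_ideal_contains_factor (S : idomainType) (I : set S) (F u : S) (s : seq S) :
  prime_ideal I -> u \is a GRing.unit -> F = u * \prod_(p <- s) p -> I F ->
  exists2 p, p \in s & I p.
Proof.
move=> pI uu -> ; have [I0 _ IM] := prime_ideal_is_ideal pI.
have [I1 Ip] := prime_idealP pI.
case/Ip => [Iu|]; first by case: I1; rewrite -(mulVr uu); exact: IM.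
elim: s => [|p s IH]; first by rewrite big_nil => /I1.
rewrite big_cons => /Ip[Ip'|/IH[q qs Iq]]; first by exists p; rewrite ?mem_head.
by exists q; rewrite // inE qs orbT.
Qed.

Section Divisors.
Variables (R : realType) (a b c r : nat).
Hypothesis a_gt0 : (0 < a)%N.
Hypothesis co_ab : coprime a b.
Local Open Scope classical_set_scope.

Local Notation K := R[i].
Local Notation S := {mpoly R[i][3]}.
Local Notation wd := (wdeg a b c).
Local Notation order_along := (@order_along K a b c).

Lemma proj_inj (p q : proj R a b c) : proj_ideal p = proj_ideal q -> p = q.
Proof.
by case: p q => [I p1 p2 p3] [J q1 q2 q3] /= IJ; subst J; congr Proj;
  exact: Prop_irrelevance.
Qed.

Lemma curve_inj (C D : curve R a b c) :
  proj_ideal (curve_point C) = proj_ideal (curve_point D) -> C = D.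
Proof.
by case: C D => [p hp] [q hq] /= /proj_inj pq; subst q; congr Curve;
  exact: Prop_irrelevance.
Qed.

Lemma homog_factors (F u : S) (s : seq S) e p :
  F != 0 -> F \is e.-homog for wd -> F = u * \prod_(q <- s) q -> p \in s ->
  exists k, p \is k.-homog for wd.
Proof.
move=> F0 Fe FE ps; pose G := u * \prod_(q <- rem p s) q.
have FG : F = p * G by rewrite FE (perm_big _ (perm_to_rem ps)) big_cons mulrCA.
by apply: (@homog_factor _ _ _ _ G e); rewrite -FG.
Qed.

(* A homogeneous prime factor p lying in the ideal of a curve generates it,
   because (p) is a homogeneous prime ideal and the ideal of the curve is
   minimal. *)
Lemma curve_principal_of (C : curve R a b c) (p : S) k :
  prime_element p -> p \is k.-homog for wd -> proj_ideal (curve_point C) p ->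
  forall g, proj_ideal (curve_point C) g <-> divides p g.
Proof.
move=> [p0 pu pP] pk Cp; have [_ Cmin] := curve_codim1 C.
have [C0 _ CM] := prime_ideal_is_ideal (proj_prime C).
pose I : set S := [set g | divides p g].
have IC : I `<=` proj_ideal (curve_point C) by move=> _ [g ->]; exact: CM.
have inI g : (g \in mem I) = `[< divides p g >].
  by apply/idP/asboolP; rewrite inE.
have I_prime : prime_ideal I.
  split; [split=> [||x f g]|move=> f g]; rewrite ?inI.
  - by apply/asboolP; exists 0; rewrite mul0r.
  - apply/negP => /asboolP[x x1]; case/negP: pu; apply/unitrP; exists x.
    by rewrite [p * x]mulrC -x1.
  - move=> /asboolP[f' ->] /asboolP[g' ->]; apply/asboolP.
    by exists (x * f' + g'); rewrite mulrDl mulrA.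
  by move=> /asboolP/pP[|] H; apply/orP; [left|right]; apply/asboolP.
have I_homog : homog_ideal a b c I.
  move=> _ [g ->] d; rewrite mulrC; have [kd|dk] := leqP k d.
    by rewrite -(subnKC kd) (pihomog_mull _ _ pk); eexists; rewrite mulrC.
  exists 0; rewrite mul0r -coef_grade rmorphM /= (grade_homog pk).
  by rewrite -mul_polyC -mulrA coefCM coefXnM dk mulr0.
have I_rel : ~ @irrelevant_ideal R a b c `<=` I.
  by move=> H; apply: (proj_relevant (p := C)); exact: subset_trans IC.
have Q := Cmin (Proj I_prime I_homog I_rel) IC.
have <- : Proj I_prime I_homog I_rel = C.
  apply: Q => /= I0; have : I p by exists 1; rewrite mul1r.
  by rewrite I0 /= => /eqP; rewrite (negbTE p0).
by [].
Qed.

(** A nonzero component of a member of the ideal of C has a prime factor in that ideal, and this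
    factor is again homogeneous. *)
Lemma curve_principal (C : curve R a b c) :
  exists p, prime_element p /\
    forall g, proj_ideal (curve_point C) g <-> divides p g.
Proof.
have [Cn0 _] := curve_codim1 C.
have [C0 _ _] := prime_ideal_is_ideal (proj_prime C).
have [f [Cf f0]] : exists f, proj_ideal (curve_point C) f /\ f != 0.
  apply: contrapT => /forallNP nf; apply: Cn0; apply/seteqP; split=> f /=.
    by move=> Cf; apply: contrapT => /eqP f0; apply: (nf f).
  by move=> ->.
have [d fd] : exists d, pihomog wd d f != 0.
  apply: contrapT => /forallNP nd; case/eqP: f0.
  rewrite (pihomog_partitionE (leqnn (mmeasure wd f))) big1 // => i _.
  by apply/eqP; apply: contrapT => /negP; exact: nd.
have [u [s [uu sp E]]] := mpoly_factorial fd.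
have [p ps Cp] := prime_ideal_contains_factor (proj_prime C) uu E
  (proj_homog Cf d).
have [k pk] := homog_factors fd (pihomogP _ _ _) E ps.
by exists p; split; [exact: sp|exact: curve_principal_of (sp p ps) pk Cp].
Qed.

(** A curve through F is generated by one of the prime factors of F, and a generator determines its
    curve. *)
Lemma curves_through (F : S) e : F != 0 -> F \is e.-homog for wd ->
  exists L : seq (curve R a b c),
    uniq L /\ forall C, proj_ideal (curve_point C) F -> C \in L.
Proof.
move=> F0 Fe; have [u [s [uu sp E]]] := mpoly_factorial F0.
pose gen p (C : curve R a b c) :=
  forall g, proj_ideal (curve_point C) g <-> divides p g.
pose pick p := if pselect (exists C, gen p C) is left h
  then Some (projT1 (cid h)) else None.
exists (undup (pmap pick s)); split; first exact: undup_uniq.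
move=> C CF; rewrite mem_undup.
have [p ps Cp] := prime_ideal_contains_factor (proj_prime C) uu E CF.
have [k pk] := homog_factors F0 Fe E ps.
have genC := curve_principal_of (sp p ps) pk Cp.
suff pickC : pick p = Some C.
  by rewrite mem_pmap -pickC map_f.
rewrite /pick; case: pselect => [h|[]]; last by exists C.
congr Some; apply: curve_inj; apply/funext => g; apply/propext.
by case: cid => D genD /=; split=> [/genD/genC|/genC/genD].
Qed.

Variable P : 'I_r -> proj R a b c.
Variable v : 'I_r -> 'I_3 -> K.
Hypothesis v_neq0 : forall i e, v i e != 0.
Hypothesis PE : forall i, proj_ideal (P i) = orbit_ideal a b c (v i).

Lemma center_order (V : prime_divisor R a b c r) :
  exists val, order_along (center P V) val.
Proof.
case: V => [C|i] /=; last by rewrite PE; 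
  exact: (@orbit_order R[i] a b c a_gt0 co_ab (v i) (v_neq0 i)).
have [p [pp Cp]] := curve_principal C.
exact: principal_order pp Cp.
Qed.

Definition ord (V : prime_divisor R a b c r) : S -> nat :=
  projT1 (cid (center_order V)).

Lemma ordP V : order_along (center P V) (ord V).
Proof. by rewrite /ord; case: cid. Qed.

Lemma ord_symbolic V F e k : F != 0 -> F \is e.-homog for wd ->
  symbolic_pow (center P V) k F <-> (k <= ord V F)%N.
Proof. exact: (ordP V).1. Qed.

Lemma ordM V F G : F != 0 -> G != 0 -> ord V (F * G) = (ord V F + ord V G)%N.
Proof. exact: (ordP V).2. Qed.

Lemma ord1 V : ord V 1 = 0%N.
Proof. by apply: (@addnI (ord V 1)); rewrite addn0 -ordM ?oner_neq0 // mulr1. Qed.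

Lemma div_sectionP F e (D : weil_divisor R a b c r) : F != 0 ->
  F \is e.-homog for wd ->
  div_section P F D <-> forall V, coeff V D = (ord V F)%:Z.
Proof.
move=> F0 Fe; split=> H V.
  have [k [-> /(ord_symbolic V k F0 Fe) k1]] := H V.
  rewrite (ord_symbolic V k.+1 F0 Fe) => /negP; rewrite -leqNgt => k2.
  by congr Posz; apply/eqP; rewrite eqn_leq k1.
exists (ord V F); split; first exact: H.
  exact/(ord_symbolic V _ F0 Fe).
by move/(ord_symbolic V _ F0 Fe); rewrite ltnn.
Qed.

Lemma div_sectionM F G e e' (D E : weil_divisor R a b c r) :
  F != 0 -> F \is e.-homog for wd -> G != 0 -> G \is e'.-homog for wd ->
  div_section P F D -> div_section P G E -> div_section P (F * G) (D + E).
Proof.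
move=> F0 Fe G0 Ge /(div_sectionP _ F0 Fe) FD /(div_sectionP _ G0 Ge) GE.
apply/(div_sectionP _ (mulf_neq0 F0 G0) (dhomogM Fe Ge)) => V.
by rewrite coeffD FD GE ordM.
Qed.

Lemma div_sectionX F e (D : weil_divisor R a b c r) k :
  F != 0 -> F \is e.-homog for wd -> div_section P F D ->
  div_section P (F ^+ k) (D *+ k).
Proof.
move=> F0 Fe FD; elim: k => [|k IH].
  have h1 : (1 : S) \is 0.-homog for wd by exact: dhomog1.
  apply/(div_sectionP _ (oner_neq0 S) h1) => V.
  by rewrite mulr0n coeff0 ord1.
rewrite exprS mulrS; apply: div_sectionM FD IH => //; first exact: Fe.
  by rewrite expf_neq0.
exact: dhomogMn Fe.
Qed.

Lemma div_section_exists F e : F != 0 -> F \is e.-homog for wd ->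
  exists D : weil_divisor R a b c r, div_section P F D.
Proof.
move=> F0 Fe; have [L [uL LP]] := curves_through F0 Fe.
pose D : weil_divisor R a b c r :=
  \sum_(C <- L) << (ord (inl C) F)%:Z *g inl C >> +
  \sum_i << (ord (inr i) F)%:Z *g inr i >>.
exists D; apply/(div_sectionP _ F0 Fe) => -[C|i]; rewrite coeffD !raddf_sum /=.
  rewrite [X in _ + X]big1 ?addr0 => [|i _]; last by rewrite coeffU mulr0.
  have [CL|nCL] := boolP (C \in L).
    rewrite (bigD1_seq C) //= coeffU eqxx mulr1 big1 ?addr0 // => C' C'C.
    rewrite coeffU (_ : (inl C' == inl C) = false) ?mulr0 //.
    exact/negbTE.
  rewrite big_seq big1 => [|C' C'L].
    suff /eqP : ord (inl C) F == 0%N by move=> ->.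
    (* A positive order gives s F in the ideal of C for some s outside it, so C passes through F. *)
    rewrite -leqn0 leqNgt; apply: contra nCL => ordC; apply: LP.
    have /(ord_symbolic _ _ F0 Fe) := ordC; move=> [s nCs [N [g [h [Cg _ sF]]]]].
    have [C0 CD CM] := prime_ideal_is_ideal (proj_prime C).
    have [_ Cp] := prime_idealP (proj_prime C).
    have /Cp[/nCs//|//] : proj_ideal (curve_point C) (s * F).
    rewrite sF; elim/big_ind: _ => // j _; rewrite mulrC; apply: CM; exact: Cg.
  rewrite coeffU (_ : (inl C' == inl C) = false) ?mulr0 //.
  by apply/negbTE; apply: contraNneq nCL => -[<-].
rewrite big1 ?add0r => [|C _]; last by rewrite coeffU mulr0.
rewrite (bigD1 i) //= coeffU eqxx mulr1 big1 ?addr0 // => j ji.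
by rewrite coeffU (_ : (inr j == inr i) = false) ?mulr0 //; exact/negbTE.
Qed.

End Divisors.

(** * Negative curves from forms with prescribed multiplicities *)

Section NegativeCurve.
Variables (R : realType) (a b c r : nat).
Hypotheses (a_gt0 : (0 < a)%N) (b_gt0 : (0 < b)%N) (c_gt0 : (0 < c)%N).
Hypothesis co_ab : coprime a b.
Variable P : 'I_r -> proj R a b c.
Variable v : 'I_r -> 'I_3 -> R[i].
Hypothesis v_neq0 : forall i e, v i e != 0.
Hypothesis PE : forall i, proj_ideal (P i) = orbit_ideal a b c (v i).
Local Notation wd := (wdeg a b c).
Local Notation S := {mpoly R[i][3]}.

Lemma coeff_exceptional_sum (V : prime_divisor R a b c r) :
  coeff V (exceptional_sum R a b c r) = (if V is inr _ then 1 else 0).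
Proof.
rewrite raddf_sum /=; case: V => [C|i].
  by apply: big1 => i _; rewrite coeffU mulr0.
rewrite (bigD1 i) //= coeffU eqxx mulr1 big1 ?addr0 // => j ji.
by rewrite coeffU (_ : (inr j == inr i) = false) ?mulr0 //; exact/negbTE.
Qed.

Lemma negative_curve_of_form (A : weil_divisor R a b c r) (F : S) e m :
  pullback_O1 P A -> F != 0 -> F \is e.-homog for wd -> (0 < e)%N -> (0 < m)%N ->
  (forall i, multiplicity_ge m (v i) F) -> (e ^ 2 < a * b * c * r * m ^ 2)%N ->
  exists D, E_uniform_negative_curve P A D.
Proof.
move=> [k [l [F0 [G0 [DF0 [DG0 [[nF0 F0k DF0P] [nG0 G0l DG0P] kl ->]]]]]]].
set A' := DF0 - DG0; move=> nF Fe e0 m0 Fm lt.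
have [DF DFP] := div_section_exists a_gt0 co_ab v_neq0 PE nF Fe.
pose D := DF - exceptional_sum R a b c r *+ m.
have kl1 : (k = l.+1)%N by lia.
have lin : lin_equiv P D (A' *+ e - exceptional_sum R a b c r *+ m).
  (* With A the divisor of F0 / G0, the function F G0^e / F0^e has degree 0 because k = l + 1, and
     its divisor is div F - e A. *)
  exists (k * e)%N, (k * e)%N, (F * G0 ^+ e), (F0 ^+ e), (DF + DG0 *+ e), (DF0 *+ e).
  have G0e : G0 ^+ e \is (l * e).-homog for wd by exact: dhomogMn.
  split.
  - split; first by rewrite mulf_neq0 ?expf_neq0.
      by rewrite kl1 mulSn; exact: dhomogM.
    apply: (div_sectionM a_gt0 co_ab v_neq0 PE nF Fe _ G0e DFP).
      by rewrite expf_neq0.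
    exact: (div_sectionX a_gt0 co_ab v_neq0 PE _ nG0 G0l DG0P).
  - split; [by rewrite expf_neq0|exact: dhomogMn|].
    exact: (div_sectionX a_gt0 co_ab v_neq0 PE _ nF0 F0k DF0P).
  - by rewrite subrr.
  by rewrite /D /A' mulrnBl opprB addrA subrK opprB addrA.
exists D; split.
- move=> V; rewrite coeffB coeffMn coeff_exceptional_sum.
  have /(_ V) -> := (div_sectionP a_gt0 co_ab v_neq0 PE DF nF Fe).1 DFP.
  case: V => [C|i]; first by rewrite mul0rn subr0.
  rewrite subr_ge0 natz lez_nat.
  apply/(ord_symbolic a_gt0 co_ab v_neq0 PE (inr i) m nF Fe).
  rewrite /= PE.
  exact: (@multiplicity_symbolic_pow R[i] a b c a_gt0 co_ab (v i) m e F (v_neq0 i)).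
- by exists e, m.
exists ((e%:Z * e%:Z)%:~R / (a * b * c)%:R - (\sum_(i < r) m%:Z * m%:Z)%:~R : rat).
  have E : A' *+ e - exceptional_sum R a b c r *+ m =
    A' *~ e%:Z - \sum_i exceptional R a b c i *~ m%:Z.
    by rewrite -pmulrn -sumrMnl.
  by exists e%:Z, e%:Z, (fun=> m%:Z), (fun=> m%:Z); rewrite -E; split.
rewrite sumr_const card_ord subr_lt0 ltr_pdivrMr; last first.
  by rewrite ltr0n !muln_gt0 a_gt0 b_gt0 c_gt0.
rewrite -[(a * b * c)%:R]/((a * b * c)%:~R) -intrM ltr_int.
rewrite -mulr_natr natz -!PoszM ltz_nat.
by move: lt; rewrite -!mulnn; lia.
Qed.

End NegativeCurve.

(** * Points on an arrangement of lines *)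

Lemma ord3_ind (Q : 'I_3 -> Prop) : Q 0 -> Q 1 -> Q 2 -> forall e, Q e.
Proof.
by move=> Q0 Q1 Q2 [[|[|[|//]]] he]; [move: Q0|move: Q1|move: Q2];
  congr Q; apply: val_inj.
Qed.

Lemma prod_ord3 (A : comNzRingType) (F : 'I_3 -> A) :
  \prod_e F e = F 0 * F 1 * F 2.
Proof.
rewrite !big_ord_recl big_ord0 mulr1 mulrA.
by congr (F _ * F _ * F _); apply: val_inj.
Qed.

Lemma mdeg3 (m : 'X_{1..3}) :
  mdeg m = (m (0%R : 'I_3) + m (1%R : 'I_3) + m (2%R : 'I_3))%N.
Proof.
rewrite mdegE !big_ord_recl big_ord0 addn0 addnA.
by congr (m _ + m _ + m _)%N; apply: val_inj.
Qed.

Lemma mmap_homog n k (A : comNzRingType) (h : 'I_n -> {mpoly A[k]}) d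
    (F : {mpoly A[n]}) :
  (forall e, h e \is 1.-homog) -> F \is d.-homog ->
  mmap (@mpolyC k A) h F \is d.-homog.
Proof.
move=> h1 Fd; rewrite /mmap big_seq; apply: rpred_sum => m mF.
rewrite mul_mpolyC; apply: dhomogZ.
have <- : mdeg m = d := dhomog_mf Fd mF.
rewrite mdegE /mmap1; elim/big_ind2: _ => [|p x q y px qy|e _].
- exact: dhomog1.
- exact: dhomogM.
- by rewrite -[X in X.-homog]mul1n; exact: dhomogMn.
Qed.

Lemma homog0_const n (A : comNzRingType) (mf : measure n) (F : {mpoly A[n]}) :
  (forall e, (0 < mf U_(e)%MM)%N) -> F \is 0.-homog for mf -> F = (F@_0%MM)%:MP.
Proof.
move=> w0 F0; apply/mpolyP => m; rewrite mcoeffC.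
have [->|m0] := eqVneq m 0%MM; first by rewrite mulr1.
rewrite mulr0; apply: (dhomog_nemf_coeff F0); apply: contra m0.
rewrite mfE sum_nat_eq0 => /forallP H; apply/eqP/mnmP => e.
by have := H e; rewrite muln_eq0 (gtn_eqF (w0 e)) orbF mnm0E => /eqP.
Qed.

Lemma mdeg_homog0_const n (A : comNzRingType) (F : {mpoly A[n]}) :
  F \is 0.-homog -> F = (F@_0%MM)%:MP.
Proof. by apply: homog0_const => e; rewrite /= mdeg1. Qed.

Definition vec3 T (x y z : T) (e : 'I_3) : T := tnth [tuple x; y; z] e.

Lemma vec3E T (x y z : T) :
  ((vec3 x y z 0 = x) * (vec3 x y z 1 = y) * (vec3 x y z 2 = z))%type.
Proof. by []. Qed.

Section LineArrangement.
Variable K : realFieldType.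
Local Notation S := {mpoly K[3]}.

(* The line l is x = slope_const l + slope l * y in the chart z = 1, and its
   i-th point has ordinate (ordinate l i).  The lines 0, 1, 2 form a triangle
   with vertices at y = 0, -1, -2; the others are the parallels x = 3 - l. *)
Definition slope_const (l : nat) : int :=
  match l with 0 => 1 | 1 => 1 | 2 => 3 | l'.+3 => - l'%:Z end.
Definition slope (l : nat) : int := match l with 1 => 1 | 2 => 2 | _ => 0 end.
Definition ordinate (l i : nat) : int :=
  match l with 0 => i.+2%:Z | 1 => i.+1%:Z | 2 => i.+2%:Z | _ => i%:Z end.
Definition abscissa l i : int := slope_const l + slope l * ordinate l i.

Lemma abscissa_off_lines l l' i : l != l' ->
  abscissa l i != slope_const l' + slope l' * ordinate l i.
Proof.
by case: l l' => [|[|[|l]]] [|[|[|l']]] // ll'; rewrite /abscissa /=; lia.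
Qed.

Lemma ordinate_inj l : injective (ordinate l).
Proof. by case: l => [|[|[|l]]] i j /= ij; lia. Qed.

Definition pt l i : 'I_3 -> K :=
  vec3 1 (abscissa l i)%:~R (ordinate l i)%:~R.

Definition line l : S :=
  'X_1 - (slope_const l)%:~R *: 'X_0 - (slope l)%:~R *: 'X_2.

Definition on_line l (F : S) : {poly K} :=
  mmap polyC (vec3 1 ((slope_const l)%:~R%:P + (slope l)%:~R *: 'X) 'X) F.

HB.instance Definition _ l := GRing.RMorphism.copy (on_line l)
  (mmap polyC (vec3 1 ((slope_const l)%:~R%:P + (slope l)%:~R *: 'X) 'X)).

Lemma horner_on_line l F y :
  (on_line l F).[y] = F.@[vec3 1 ((slope_const l)%:~R + (slope l)%:~R * y) y].
Proof.
rewrite -[LHS]/(horner_eval y (on_line l F)) /on_line rmorph_mmap.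
apply: eq_mmap => [x|e] /=; rewrite /horner_eval ?hornerC //.
by elim/ord3_ind: e; rewrite !vec3E /= ?hornerE.
Qed.

Lemma on_line_pt l i F : (on_line l F).[(ordinate l i)%:~R] = F.@[pt l i].
Proof. by rewrite horner_on_line /pt /abscissa rmorphD rmorphM. Qed.

Lemma on_line_line l l' i : l != l' ->
  (on_line l (line l')).[(ordinate l i)%:~R] != 0.
Proof.
move=> ll'; rewrite on_line_pt /line !rmorphB /= !mevalZ !mevalXU.
rewrite /pt !vec3E mulr1 -intrM -!intrB intr_eq0.
have := abscissa_off_lines i ll'; lia.
Qed.

Lemma line_pt l i : (line l).@[pt l i] = 0.
Proof.
rewrite /line !rmorphB /= !mevalZ !mevalXU /pt !vec3E mulr1.
by rewrite /abscissa intrD intrM addrAC addrK subrr.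
Qed.

Lemma line_homog l : line l \is 1.-homog.
Proof.
have X1 (e : 'I_3) : ('X_e : S) \is 1.-homog by rewrite dhomogX /= mdeg1.
by rewrite /line; apply: rpredB; [apply: rpredB|]; rewrite ?dhomogZ.
Qed.

(* After the change of variables 'X_1 -> line l, vanishing on the line means
   divisibility by a variable. *)
Lemma line_divides l d (F : S) : F \is d.-homog -> on_line l F = 0 ->
  exists2 Q, Q \is (d - 1).-homog & F = line l * Q.
Proof.
move=> Fd F0.
pose s : S -> S := mmap (@mpolyC 3 K) (vec3 'X_0
  ('X_1 + (slope_const l)%:~R *: 'X_0 + (slope l)%:~R *: 'X_2) 'X_2).
pose s' : S -> S := mmap (@mpolyC 3 K) (vec3 'X_0 (line l) 'X_2).
have s'K G : s' (s G) = G.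
  have H : s' \o s =1 idfun.
    apply: (rmorph_mpolyP (u := s' \o s) (u' := idfun)) => [x|e] /=.
      by rewrite /s /s' !mmapC.
    rewrite /s mmapX mmap1U /s'.
    elim/ord3_ind: e; rewrite vec3E /=.
    - by rewrite mmapX mmap1U vec3E.
    - rewrite !rmorphD /= !mmapZ !mmapX !mmap1U !vec3E !mul_mpolyC.
      by rewrite addrAC subrK subrK.
    - by rewrite mmapX mmap1U vec3E.
  exact: H.
have sFE : on_line l F = mmap polyC (vec3 1 0 'X) (s F).
  rewrite /s rmorph_mmap; apply: eq_mmap => [x|e] /=; first by rewrite mmapC.
  elim/ord3_ind: e; rewrite vec3E /=.
  - by rewrite mmapX mmap1U vec3E.
  - rewrite !rmorphD /= !mmapZ !mmapX !mmap1U !vec3E add0r mulr1.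
    by rewrite mul_polyC.
  - by rewrite mmapX mmap1U vec3E.
have X1 (e : 'I_3) : ('X_e : S) \is 1.-homog by rewrite dhomogX /= mdeg1.
have sFd : s F \is d.-homog.
  apply: mmap_homog => // e; elim/ord3_ind: e; rewrite vec3E //.
  by rewrite !rpredD ?dhomogZ.
(* Restriction to the line now sets ['X_1] to 0 and ['X_0] to 1. In a fixed degree, a monomial free
   of ['X_1] is determined by its exponent of ['X_2], so no such monomials cancel. *)
have sF1 m : m \in msupp (s F) -> (0 < m (1%R : 'I_3))%N.
  move=> ms; rewrite lt0n; apply: contraL (ms) => /eqP m1.
  rewrite mcoeff_msupp negbK; apply/eqP.
  have : (on_line l F)`_(m (2%R : 'I_3)) = 0 by rewrite F0 coef0.
  have coefE g k : (((s F)@_g)%:P * mmap1 (vec3 1 0 'X) g)`_k =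
      (s F)@_g * ((g (1%R : 'I_3) == 0%N) && (k == g (2%R : 'I_3)))%:R.
    rewrite coefCM /mmap1 prod_ord3 !vec3E expr1n mul1r expr0n.
    by case: eqP => _; rewrite ?mul1r ?mul0r ?coefXn ?coef0.
  rewrite sFE /mmap coef_sum (bigD1_seq m) ?msupp_uniq //= big_seq_cond big1.
    by rewrite coefE m1 !eqxx mulr1 addr0.
  move=> g /andP[gs gm]; rewrite coefE; case: eqP => g1; last by rewrite mulr0.
  case: eqP => g2; last by rewrite mulr0.
  case/eqP: gm; apply/mnmP => e.
  have gd : mdeg g = d := dhomog_mf sFd gs; have md : mdeg m = d := dhomog_mf sFd ms.
  move: gd md; rewrite !mdeg3 g1 g2 m1 => <- gm.
  elim/ord3_ind: e; rewrite ?g1 ?g2 ?m1 //.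
  by apply/eqP; rewrite -(eqn_add2r (g (2%R : 'I_3))); apply/eqP; lia.
pose Q := \sum_(m <- msupp (s F)) (s F)@_m *: 'X_[m - U_(1%R)].
have FQ : F = line l * s' Q.
  have -> : line l = s' 'X_1 by rewrite /s' mmapX mmap1U vec3E.
  rewrite -[F]s'K -rmorphM; congr s'; rewrite mulr_sumr {1}[s F]mpolyE big_seq
    [RHS]big_seq; apply: eq_bigr => m /sF1 m1.
  rewrite -scalerAr -mpolyXD addmC submK //; apply/mnm_lepP => e.
  by rewrite mnm1E; case: eqP => // <-.
case: d Fd sFd => [|d] Fd sFd.
  exists 0; first exact: dhomog0.
  move: F0; rewrite mulr0 (mdeg_homog0_const Fd) /on_line mmapC => /polyC_inj ->.
  exact: mpolyC0.
(* The quotient need not be known to be homogeneous; its component of degree d does as well. *)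
exists (pihomog mdeg d (s' Q)); first by rewrite subn1; exact: pihomogP.
rewrite -{1}(pihomog_dE Fd) {1}FQ.
exact: (pihomog_mull d (s' Q) (line_homog l)).
Qed.

Lemma size_on_line l d (F : S) : F \is d.-homog -> (size (on_line l F) <= d.+1)%N.
Proof.
move=> Fd; rewrite /on_line /mmap; apply: (leq_trans (size_sum _ _ _)).
apply/bigmax_leqP_seq => m mF _; rewrite mul_polyC.
apply: (leq_trans (size_scale_leq _ _)).
have <- : mdeg m = d := dhomog_mf Fd mF.
rewrite mdegE /mmap1; elim/big_ind2: _ => [|p x q y px qy|e _].
- by rewrite size_poly1.
- have aux i j : (i <= x.+1 -> j <= y.+1 -> (i + j).-1 <= (x + y).+1)%N by lia.
  by apply: (leq_trans (size_mul_leq _ _)); exact: aux.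
set p := vec3 _ _ _ e; have sp : (size p <= 2)%N.
  rewrite /p; elim/ord3_ind: e {p}; rewrite vec3E.
  - by rewrite size_poly1.
  - rewrite (leq_trans (size_polyD _ _)) // geq_max (leq_trans (size_polyC_leq1 _)) //.
    by rewrite (leq_trans (size_scale_leq _ _)) ?size_polyX.
  by rewrite size_polyX.
apply: (leq_trans (size_exp_leq _ _)); rewrite ltnS.
by rewrite -[X in (_ <= X)%N]mul1n leq_mul2r -subn1 leq_subLR sp orbT.
Qed.

Lemma on_line_multiplicity l i m (F : S) : multiplicity_ge m (pt l i) F ->
  ('X - (ordinate l i)%:~R%:P) ^+ m %| on_line l F.
Proof.
move=> Fm; set y := (ordinate l i)%:~R.
have E : on_line l F \Po ('X + y%:P) =
    mmap polyC (vec3 0 ((slope l)%:~R *: 'X) 'X) (translate (pt l i) F).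
  rewrite -[LHS]/(comp_poly ('X + y%:P) (on_line l F)) /on_line /translate.
  rewrite !rmorph_mmap; apply: eq_mmap => [x|e] /=.
    by rewrite comp_polyC mmapC.
  rewrite rmorphD /= mmapX mmap1U mmapC.
  elim/ord3_ind: e; rewrite /pt !vec3E /=.
  - by rewrite comp_polyC add0r.
  - rewrite comp_polyD comp_polyC comp_polyZ comp_polyX scalerDr /abscissa.
    rewrite intrD intrM polyCD polyCM -!mul_polyC -/y; ring.
  by rewrite comp_polyX.
have : 'X^m %| on_line l F \Po ('X + y%:P).
  rewrite E /mmap big_seq; elim/big_ind: _ => [|p q pm qm|p ps].
  - by rewrite dvdp0.
  - by rewrite dvdp_addr.
  have mp : (m <= mdeg p)%N.
    rewrite leqNgt; apply: contraL ps => pm; rewrite mcoeff_msupp.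
    by rewrite (Fm p pm) eqxx.
  apply: dvdp_mull; apply: (dvdp_trans (dvdp_exp2l 'X mp)).
  rewrite mdegE expr_sum /mmap1.
  apply: (big_ind2 (fun p q : {poly K} => p %| q)) => [|p1 q1 p2 q2 H1 H2|e _].
  - exact: dvdpp.
  - exact: dvdp_mul.
  apply: dvdp_exp2r; elim/ord3_ind: e; rewrite vec3E.
  - exact: dvdp0.
  - by rewrite -mul_polyC dvdp_mull.
  exact: dvdpp.
move=> /dvdpP[q qE]; apply/dvdpP; exists (q \Po ('X - y%:P)).
have := congr1 (comp_poly ('X - y%:P)) qE.
rewrite -comp_polyA comp_polyD comp_polyX comp_polyC subrK comp_polyXr => ->.
by rewrite comp_polyM rmorphXn /= comp_polyX.
Qed.

End LineArrangement.

Section ProdXsubCExp.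
Variable K : fieldType.

Lemma prod_XsubC_exp_dvd (y : nat -> K) (mu : nat -> nat) k (q : {poly K}) :
  injective y -> (forall i, (i < k)%N -> ('X - (y i)%:P) ^+ mu i %| q) ->
  \prod_(i < k) ('X - (y i)%:P) ^+ mu i %| q.
Proof.
move=> y_inj; elim: k => [_|k IH qP]; first by rewrite big_ord0 dvd1p.
rewrite big_ord_recr /= Gauss_dvdp ?qP // ?andbT.
  by apply: IH => i ik; apply: qP; exact: leqW.
apply: coprimep_expr; rewrite coprimep_XsubC /root horner_prod.
apply/prodf_neq0 => i _; rewrite horner_exp hornerXsubC expf_neq0 // subr_eq0.
by rewrite (inj_eq y_inj) gtn_eqF.
Qed.

Lemma size_prod_XsubC_exp (y : nat -> K) (mu : nat -> nat) k :
  size (\prod_(i < k) ('X - (y i)%:P) ^+ mu i) = (\sum_(i < k) mu i).+1.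
Proof.
elim: k => [|k IH]; first by rewrite !big_ord0 size_poly1.
rewrite !big_ord_recr /= size_mul ?IH ?size_exp_XsubC ?addnS //.
  by rewrite -size_poly_gt0 IH.
by rewrite expf_neq0 // polyXsubC_eq0.
Qed.

End ProdXsubCExp.

Section LineProduct.
Variables (K : realFieldType) (k : nat).
Hypothesis k_gt3 : (3 < k)%N.
Local Notation S := {mpoly K[3]}.
Local Notation line := (@line K).
Local Notation pt := (@pt K).
Local Notation yK l i := ((ordinate l i)%:~R : K).

Lemma ordinateK_inj l : injective (fun i => yK l i).
Proof. by move=> i j /intr_inj/ordinate_inj. Qed.

Definition lines : S := \prod_(l < k) line l.

(* Comparing the restrictions to the three sides of the triangle at its
   vertices forces a nonzero form of degree k j with j-fold zeros at all the
   points of the sides to satisfy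
   prod (i+2)^j (i+3)^j = prod (i+1)^j (i+4)^j. *)
Lemma triangle_vanishing j (F : S) : (0 < j)%N -> F \is (k * j).-homog ->
  (forall l i, (l < 3)%N -> (i < k)%N -> multiplicity_ge j (pt l i) F) ->
  forall l, (l < 3)%N -> on_line l F = 0.
Proof.
move=> j0 Fd Fm; pose E l : {poly K} := \prod_(i < k) ('X - (yK l i)%:P) ^+ j.
have restE l : (l < 3)%N -> exists c, on_line l F = c *: E l.
  move=> l3; have dvdE : E l %| on_line l F.
    apply: (@prod_XsubC_exp_dvd _ (fun i => yK l i) (fun=> j)) => [|i ik].
      exact: ordinateK_inj.
    by apply: on_line_multiplicity; exact: Fm.
  have [->|F0] := eqVneq (on_line l F) 0; first by exists 0; rewrite scale0r.
  have sE : size (E l) = (k * j).+1.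
    by rewrite [LHS](size_prod_XsubC_exp (fun i => yK l i) (fun=> j))
      sum_nat_const card_ord.
  (* The restriction has degree at most k j, which is the degree of its divisor [E l]. *)
  have /eqpP[[c1 c2] /= /andP[c10 c20] c12] : E l %= on_line l F.
    rewrite -(dvdp_size_eqp dvdE) sE eqn_leq -{1}sE dvdp_leq //=.
    exact: size_on_line.
  exists (c2^-1 * c1); rewrite -scalerA c12 scalerA mulVf ?scale1r //.
have [c0 E0] := restE 0%N isT; have [c1 E1] := restE 1%N isT.
have [c2 E2] := restE 2%N isT.
have meet l l' y : slope_const l + slope l * y = slope_const l' + slope l' * y ->
    (on_line l F).[y%:~R] = (on_line l' F).[y%:~R].
  by move=> H; rewrite !horner_on_line -!intrM -!intrD H.
have hE l (y : int) : (E l).[y%:~R] = ((\prod_(i < k) (y - ordinate l i)) ^+ j)%:~R.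
  rewrite horner_prod -prodrXl rmorph_prod; apply: eq_bigr => i _.
  by rewrite horner_exp hornerXsubC -intrB rmorphXn.
have m01 := meet 0%N 1%N 0 erefl; have m02 := meet 0%N 2%N (-1) erefl.
have m12 := meet 1%N 2%N (-2) erefl.
move: m01 m02 m12; rewrite E0 E1 E2 !hornerZ !hE.
set A0 := \prod_(i < k) (0 - ordinate 0 i).
set B0 := \prod_(i < k) (0 - ordinate 1 i).
set A1 := \prod_(i < k) (-1 - ordinate 0 i).
set B2 := \prod_(i < k) (-2 - ordinate 1 i).
set A2 := \prod_(i < k) (-2 - ordinate 2 i).
rewrite -/A1 => m01 m02 m12.
have nz (f : nat -> int) : (forall i, f i != 0) -> \prod_(i < k) f i != 0.
  by move=> f0; apply/prodf_neq0.
have B00 : B0 != 0 by apply: (nz (fun i => 0 - ordinate 1 i)) => i /=; lia.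
have A10 : A1 != 0 by apply: (nz (fun i => -1 - ordinate 0 i)) => i /=; lia.
have XK (x : int) : x != 0 -> (x ^+ j)%:~R != 0 :> K.
  by move=> x0; rewrite intr_eq0 expf_neq0.
have c02 : c0 = c2 by apply: (mulIf (XK _ A10)).
(* Up to signs that cancel, this is (i+1)(i+4) < (i+2)(i+3) factor by factor. *)
have lt : (0 <= A2 * B0 < A0 * B2).
  rewrite /A2 /B0 /A0 /B2 -!big_split /=; apply/andP; split.
    by apply: prodr_ge0 => i _ /=; nia.
  have k0 : (0 < k)%N by exact: leq_trans k_gt3.
  apply: ltr_prod => [|i _].
    by apply/hasP; exists (Ordinal k0); rewrite ?mem_index_enum.
  by rewrite /=; nia.
have c00 : c0 = 0.
  have : c0 * ((A0 * B2) ^+ j - (A2 * B0) ^+ j)%:~R = 0.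
    rewrite intrB mulrBr !exprMn !intrM !mulrA m01 mulrAC m12 -c02.
    by rewrite -!mulrA [_%:~R * (B0 ^+ j)%:~R]mulrC subrr.
  move/eqP; rewrite mulf_eq0 intr_eq0 subr_eq0 => /orP[/eqP//|/eqP EX].
  case/andP: lt => l0 l1; have := ltrXn2r j l0 l1.
  by rewrite EX ltxx -lt0n j0.
have c10 : c1 = 0.
  move: m01; rewrite c00 mul0r => /esym/eqP.
  by rewrite mulf_eq0 (negbTE (XK _ B00)) orbF => /eqP.
move=> [|[|[|//]]] _; [rewrite E0 c00|rewrite E1 c10|rewrite E2 -c02 c00];
  exact: scale0r.
Qed.

Lemma on_line_prod_neq0 l i n : (n <= l)%N ->
  (on_line l (\prod_(l' < n) line l')).[yK l i] != 0.
Proof.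
move=> nl; rewrite rmorph_prod horner_prod; apply/prodf_neq0 => l' _.
by apply: on_line_line; rewrite gtn_eqF // (leq_trans (ltn_ord l')).
Qed.

Definition mult_at j l i : nat := if ((l == 3) && (i == 0))%N then (j - 1)%N else j.

(** The triangle argument handles the first three lines. Once n >= 3 lines are divided out, the
    quotient has degree k j - n but still at least k j - 1 zeros on line n, or k j for n > 3,
    because the points of line n lie on no other line. *)
Lemma lines_divide j (F : S) : (0 < j)%N -> F \is (k * j).-homog ->
  (forall l i, (l < k)%N -> (i < k)%N ->
    multiplicity_ge (mult_at j l i) (pt l i) F) ->
  exists2 Q, Q \is (k * (j - 1)).-homog & F = lines * Q.
Proof.
move=> j0 Fd Fm.
have tri l : (l < 3)%N -> on_line l F = 0.
  apply: (triangle_vanishing j0 Fd) => l' i l3 ik.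
  have := Fm l' i (leq_trans l3 (ltnW k_gt3)) ik.
  by rewrite /mult_at (ltn_eqF l3).
have step n : (n <= k)%N -> exists2 Q, Q \is (k * j - n).-homog
    & F = (\prod_(l < n) line l) * Q.
  elim: n => [|n IH] nk; first by exists F; rewrite ?subn0 ?big_ord0 ?mul1r.
  have [Q Qd FQ] := IH (ltnW nk).
  suff Q0 : on_line n Q = 0.
    have [Q' Q'd QE] := line_divides Qd Q0; exists Q'.
      by rewrite -subnDA addn1 in Q'd.
    by rewrite big_ord_recr /= -mulrA -QE.
  have FE : on_line n F = on_line n (\prod_(l < n) line l) * on_line n Q.
    by rewrite -rmorphM -FQ.
  have pn i := on_line_prod_neq0 i (leqnn n).
  have [n3|n3] := ltnP n 3.
    apply/eqP; move/eqP: FE; rewrite (tri n n3) eq_sym mulf_eq0 => /orP[/eqP E|//].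
    by have := pn 0%N; rewrite E horner0 eqxx.
  apply/eqP; apply: contraT => Q0.
  have : \prod_(i < k) ('X - (yK n i)%:P) ^+ mult_at j n i %| on_line n Q.
    apply: (@prod_XsubC_exp_dvd _ (fun i => yK n i)) => [|i ik].
      exact: ordinateK_inj.
    rewrite -(@Gauss_dvdpr _ _ (on_line n (\prod_(l < n) line l))) -?FE.
      by apply: on_line_multiplicity; exact: Fm.
    by apply: coprimep_expl; rewrite coprimep_sym coprimep_XsubC; exact: pn.
  move/(dvdp_leq Q0); rewrite (size_prod_XsubC_exp (fun i => yK n i)).
  have -> : (\sum_(i < k) mult_at j n i = k * j - (n == 3))%N.
    case: k k_gt3 nk => // k' _ nk; rewrite big_ord_recl /= /mult_at eqxx andbT.
    rewrite (eq_bigr (fun=> j)) ?sum_nat_const ?card_ord => [|i _]; last first.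
      by rewrite /= andbF.
    by case: eqP => _; nia.
  have sQ := size_on_line n Qd; move=> sz; have := leq_trans sz sQ.
  rewrite ltnS; have : (3 < k * j)%N by nia.
  by case: eqP => [->|_]; lia.
have [Q Qd FQ] := step k (leqnn k); exists Q => //.
by rewrite (_ : k * (j - 1) = k * j - k)%N // mulnBr muln1.
Qed.

Lemma lines_order l i : (l < k)%N ->
  low_order 1 (translate (pt l i) lines) /\
  ~ low_order 2 (translate (pt l i) lines).
Proof.
move=> lk; have lE : lines = \prod_(l' < k | l' != Ordinal lk) line l' * line l.
  by rewrite /lines (bigD1 (Ordinal lk)) //= mulrC.
split=> [p|].
  rewrite ltnS leqn0 mdeg_eq0 => /eqP ->.
  by rewrite translate0 lE rmorphM /= line_pt mulr0.
rewrite lE rmorphM -[2%N]/(0 + 2)%N => H.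
have /(_ U_(1%R)%MM) : low_order 2 (translate (pt l i) (line l)).
  apply: low_order_cancel H => //; apply: low_order1N.
  rewrite translate0 rmorph_prod; apply/prodf_neq0 => l' ll' /=.
  by rewrite -on_line_pt on_line_line // eq_sym.
rewrite mdeg1 => /(_ isT); rewrite /line /translate.
rewrite !rmorphB /= !mmapZ !mmapX !mmap1U !mcoeffB !mcoeffCM !mcoeffD.
rewrite !mcoeffXU !mcoeffC !mnm1_eq0 !mulr0 !addr0 /= !mulr0 !subr0.
by move/eqP; rewrite oner_eq0.
Qed.

Lemma lines_unique j (F : S) : F \is (k * j).-homog ->
  (forall l i, (l < k)%N -> (i < k)%N ->
    multiplicity_ge (mult_at j l i) (pt l i) F) ->
  exists c, F = c *: lines ^+ j.
Proof.
elim: j F => [|j IH] F Fd Fm.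
  rewrite muln0 in Fd; exists F@_0%MM.
  by rewrite {1}(mdeg_homog0_const Fd) expr0 -mul_mpolyC mulr1.
have [Q Qd FQ] := lines_divide (ltn0Sn j) Fd Fm; rewrite subSS subn0 in Qd.
have [|c QE] := IH Q Qd; last by exists c; rewrite FQ QE exprS scalerAr.
move=> l i lk ik; have [L1 L2] := lines_order i lk.
have := Fm l i lk ik; rewrite FQ /multiplicity_ge rmorphM /mult_at.
case: ifP => _; last exact: (@low_order_cancel _ _ 1 j _ _ L2 L1).
(* At the relaxed point the multiplicity falls from j to j - 1; for j = 0 nothing is asked. *)
case: j {IH Fd Fm FQ Qd} => [|j]; first by move=> _ p.
by rewrite !subSS !subn0; exact: (@low_order_cancel _ _ 1 j _ _ L2 L1).
Qed.

End LineProduct.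

(** * A first order deformation of the arrangement *)

Section ClearDenominators.
Variables (A : idomainType) (n : nat).
Local Notation L := {fraction A}.

Local Notation tofrac := (@FracField.tofrac A).

Lemma fraction_split (x : L) : exists a b : A, a != 0 /\ tofrac a * x = tofrac b.
Proof.
elim/quotW: x => y; exists (frac y).2, (frac y).1; split; first exact: denom_ratioP.
unlock tofrac; rewrite -[LHS]FracField.pi_mul; apply/eqmodP.
rewrite /= FracField.equivfE /FracField.mulf.
rewrite !numden_Ratio ?oner_neq0 ?mulf_neq0 ?oner_neq0 ?denom_ratioP //.
by rewrite mulr1 mul1r.
Qed.

Lemma clear_denominators (F : {mpoly L[n]}) :
  exists (a : A) (G : {mpoly A[n]}), a != 0 /\ map_mpoly tofrac G = tofrac a *: F.
Proof.
have H (s : seq 'X_{1..n}) : exists2 a : A, a != 0 &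
    forall g, g \in s -> exists b, tofrac a * F@_g = tofrac b.
  elim: s => [|g s [a a0 IH]]; first by exists 1; rewrite ?oner_neq0.
  have [a' [b [a'0 bE]]] := fraction_split F@_g.
  exists (a * a'); first by rewrite mulf_neq0.
  move=> h; rewrite inE => /orP[/eqP->|/IH[b' b'E]].
    by exists (a * b); rewrite rmorphM -mulrA bE rmorphM.
  by exists (a' * b'); rewrite !rmorphM mulrAC b'E mulrC.
have [a a0 aP] := H (msupp F).
have ex g : exists b, tofrac a * F@_g = tofrac b.
  have [/aP//|/memN_msupp_eq0 ->] := boolP (g \in msupp F).
  by exists 0; rewrite mulr0 rmorph0.
have [b bE] := choice ex.
exists a, (\sum_(g <- msupp F) b g *: 'X_[g]); split=> //.
rewrite rmorph_sum {2}[F]mpolyE scaler_sumr; apply: eq_bigr => g _.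
by rewrite /= map_mpolyZ map_mpolyX scalerA bE.
Qed.

End ClearDenominators.

(** Dividing out the parameter makes the reduction at parameter 0 nonzero; the size of a fixed
    nonzero coefficient bounds the number of divisions. *)
Lemma primitive_representative (K : fieldType) n (F : {mpoly {poly K}[n]}) :
  F != 0 -> exists (j : nat) (G : {mpoly {poly K}[n]}),
    F = 'X^j *: G /\ exists g, (G@_g)`_0 != 0.
Proof.
move=> F0; have [g gF] : exists g, F@_g != 0.
  by exists (mlead F); rewrite mleadc_eq0.
have [s] := ubnP (size F@_g); elim: s F F0 gF => // s IH F F0 gF Fs.
have [ex|nex] := pselect (exists g, (F@_g)`_0 != 0).
  by exists 0%N, F; rewrite expr0 scale1r.
have dvX h : exists q, F@_h = q * 'X.
  apply/dvdpP; rewrite -['X]subr0 -polyC0 dvdp_XsubCl /root horner_coef0.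
  by apply: contrapT => /negP h0; apply: nex; exists h.
have [q qE] := choice dvX.
pose G : {mpoly {poly K}[n]} := \sum_(h <- msupp F) q h *: 'X_[h].
have FG : F = 'X *: G.
  rewrite /G scaler_sumr {1}[F]mpolyE; apply: eq_bigr => h _.
  by rewrite scalerA qE mulrC.
have gG : G@_g != 0.
  by apply: contra_neq gF => gG; rewrite FG mcoeffZ gG mulr0.
have G0 : G != 0 by apply: contra_neq gG => ->; rewrite mcoeff0.
have [|j [H [GE HP]]] := IH G G0 gG.
  by move: Fs; rewrite FG mcoeffZ mulrC size_mulX.
by exists j.+1, H; rewrite FG GE scalerA exprS.
Qed.

Section FirstOrder.
Variables (K : realFieldType) (k m : nat).
Hypotheses (k_gt3 : (3 < k)%N) (m_gt0 : (0 < m)%N).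
Local Notation A := {poly K}.
Local Notation pt := (@pt K).

(* The point (3, 0), which is (1 : 0 : 0), moves off its line in the direction
   of x; all the other points are fixed. *)
Definition moving_pt l i : 'I_3 -> A :=
  if (l == 3)%N && (i == 0)%N then vec3 1 'X 0 else polyC \o pt l i.

Definition coef_mpoly j (F : {mpoly A[3]}) : {mpoly K[3]} := map_mpoly (coefp j) F.

Lemma coef_mpolyE j F g : (coef_mpoly j F)@_g = (F@_g)`_j.
Proof. exact: mcoeff_map_mpoly. Qed.

Lemma tcoef_coef_mpoly j (v : 'I_3 -> K) p F :
  (tcoef (polyC \o v) p F)`_j = tcoef v p (coef_mpoly j F).
Proof.
have sub : {subset msupp (coef_mpoly j F) <= msupp F}.
  move=> g; rewrite !mcoeff_msupp coef_mpolyE.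
  by apply: contra_neq => ->; rewrite coef0.
rewrite (tcoefE _ _ (msupp_uniq F) sub) /tcoef coef_sum; apply: eq_bigr => g _.
rewrite [\prod_i _](_ : _ = (\prod_i (v i ^+ (g i - p i) *+ 'C(g i, p i)))%:P).
  by rewrite coefMC coef_mpolyE.
by rewrite rmorph_prod; apply: eq_bigr => e _; rewrite rmorphMn rmorphXn.
Qed.

Lemma coef_mpoly_homog j d F : F \is d.-homog -> coef_mpoly j F \is d.-homog.
Proof.
move=> /dhomogP Fd; apply/dhomogP => g; rewrite mcoeff_msupp coef_mpolyE => gF.
by apply: Fd; rewrite mcoeff_msupp; apply: contra_neq gF => ->; rewrite coef0.
Qed.

Let v0 : 'I_3 -> K := vec3 1 0 0.

(** Taylor expansion to first order in the parameter, with F = f_0 + t f_1 + ...: the derivative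
    along ['X_1] of the divided derivative p is p_1 + 1 times the divided derivative p + U_1. *)
Lemma tcoef_moving p F :
  let t := tcoef (vec3 1 'X 0) p F in
  t`_0 = tcoef v0 p (coef_mpoly 0 F) /\
  t`_1 = tcoef v0 p (coef_mpoly 1 F) +
    (p (1%R : 'I_3)).+1%:R * tcoef v0 (p + U_(1%R)) (coef_mpoly 0 F).
Proof.
have sub j : {subset msupp (coef_mpoly j F) <= msupp F}.
  move=> g; rewrite !mcoeff_msupp coef_mpolyE.
  by apply: contra_neq => ->; rewrite coef0.
rewrite /= !(tcoefE _ _ (msupp_uniq F) (sub _)) /tcoef !coef_sum mulr_sumr.
rewrite -big_split /=.
have key j (f : A) (u w : K) (e n : nat) :
    (f * (u%:P * ('X^e *+ n) * w%:P))`_j = u * w * n%:R * (f * 'X^e)`_j.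
  rewrite -coefCM; set q := _ * _; set q' := _ * _.
  suff -> : q = q' by [].
  by rewrite /q /q' !polyCM polyC_natr -mulr_natr; ring.
have C1 n l : (1 : A) ^+ n *+ l = (1 ^+ n *+ l)%:P by rewrite polyCMn polyC_exp.
have C0 n l : (0 : A) ^+ n *+ l = (0 ^+ n *+ l)%:P by rewrite polyCMn polyC_exp.
split; apply: eq_bigr => g _; rewrite !coef_mpolyE !prod_ord3 /v0 !vec3E.
  rewrite C1 C0 key coefMXn sub0n lt0n.
  move: ((1 : K) ^+ _ *+ _) ((0 : K) ^+ _ *+ 'C(g (2%R : 'I_3), _)) => u w.
  set e := (_ - _)%N; case: e => [|e]; rewrite ?expr0 ?expr0n -[in RHS]mulr_natr /=.
    by rewrite mul1r mulrC -[u * _%:R * w]mulrAC.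
  by rewrite !(mulr0, mul0r).
rewrite C1 C0 key coefMXn !mnmDE !mnm1E /= !addn0 addn1.
move: ((1 : K) ^+ _ *+ _) ((0 : K) ^+ _ *+ 'C(g (2%R : 'I_3), _)) => u w.
(* Only the exponent differences 0 and 1 matter in degree 1: the former reads off f_1, the latter
   f_0 with binomial p_1 + 1. *)
have [g1|g1] := leqP (g (1%R : 'I_3)) (p (1%R : 'I_3)).
  rewrite [in X in _ = _ + X]bin_small // mulr0n mulr0 mul0r !mulr0 addr0.
  rewrite (eqP g1) /= expr0 -[in RHS]mulr_natr mul1r.
  by rewrite mulrC -[u * _%:R * w]mulrAC.
set e := (_ - _)%N in |- *; case E : e => [|h]; first by move: g1 E; rewrite /e; lia.
have -> : (g (1%R : 'I_3) - (p (1%R : 'I_3)).+1 = h)%N by lia.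
have -> : g (1%R : 'I_3) = (p (1%R : 'I_3) + h.+1)%N by lia.
rewrite expr0n mul0rn mulr0 mul0r mulr0 add0r.
case: h {E} => [|h]; last by rewrite /= expr0n /= mul0rn !(mulr0, mul0r).
rewrite /= addn1 binSn binn expr0 mulr1n mulr1 subnn.
by rewrite [LHS]mulrC [RHS]mulrCA [u * w * _]mulrC.
Qed.

Lemma coef_axis (H : {mpoly K[3]}) n :
  (mmap polyC (vec3 0 'X 0) H)`_n = H@_(U_(1%R) *+ n).
Proof.
pose t (g : 'X_{1..3}) := (U_(1%R) *+ n == g)%MM.
have E g : ((H@_g)%:P * mmap1 (vec3 0 'X 0) g)`_n = if t g then H@_g else 0.
  rewrite coefCM /mmap1 prod_ord3 !vec3E !expr0n /t.
  have -> : (U_(1%R) *+ n == g)%MM =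
      [&& g (0%R : 'I_3) == 0%N, g (2%R : 'I_3) == 0%N & n == g (1%R : 'I_3)].
    apply/eqP/and3P => [<-|[/eqP g0 /eqP g2 /eqP g1]].
      by rewrite !mulmnE !mnm1E /= !mul0n mul1n.
    by apply/mnmP; elim/ord3_ind; rewrite mulmnE mnm1E /= ?mul0n ?mul1n.
  case: (g (0%R : 'I_3)) => [|g0]; rewrite ?mul0r ?coef0 ?mulr0 //= mul1r.
  case: (g (2%R : 'I_3)) => [|g2]; rewrite /= ?mulr0 ?coef0 ?mulr0 // mulr1.
  by rewrite coefXn; case: eqP; rewrite ?mulr1 ?mulr0.
rewrite /mmap coef_sum (eq_bigr _ (fun g _ => E g)) -big_mkcond /=.
rewrite (eq_bigr (fun=> H@_(U_(1%R) *+ n))); last by move=> g /eqP <-.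
rewrite big_const_seq iter_addr_0 (eq_count (a2 := pred1 (U_(1%R) *+ n)%MM)).
  rewrite count_uniq_mem ?msupp_uniq //.
  by have [|/memN_msupp_eq0 ->] := boolP (_ \in _); rewrite ?mulr1n ?mul0rn.
by move=> g; rewrite /t /= eq_sym.
Qed.

Lemma lines_axis : exists u : A, u.[0] != 0 /\
  mmap polyC (vec3 1 'X 0) (lines K k) = 'X * u.
Proof.
exists (\prod_(l < k | l != Ordinal k_gt3) ('X - (slope_const l)%:~R%:P)); split.
  rewrite horner_prod; apply/prodf_neq0 => l l3.
  rewrite hornerXsubC sub0r oppr_eq0 intr_eq0.
  move: l3; rewrite -val_eqE /=; case: (val l) => [|[|[|[|n]]]] //= _; lia.
rewrite rmorph_prod (bigD1 (Ordinal k_gt3)) //=.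
have E l : mmap polyC (vec3 1 'X 0) (line K l) = 'X - (slope_const l)%:~R%:P.
  rewrite /line !rmorphB /= !mmapZ !mmapX !mmap1U !vec3E mulr1 mulr0 subr0.
  by [].
rewrite [X in X * _]E /= subr0; congr (_ * _).
by apply: eq_bigr => l _; exact: E.
Qed.

Lemma first_order_obstruction (F : {mpoly A[3]}) g : F \is (k * m).-homog ->
  (F@_g)`_0 != 0 ->
  ~ (forall l i, (l < k)%N -> (i < k)%N -> multiplicity_ge m (moving_pt l i) F).
Proof.
move=> Fd Fg Fm.
have ptE : pt 3 0 = v0.
  by apply/funext; elim/ord3_ind; rewrite /pt /v0 !vec3E.
have mov p : (mdeg p < m)%N -> tcoef (vec3 1 'X 0) p F = 0.
  by move: p; apply/multiplicity_geE; exact: (Fm 3%N 0%N k_gt3 (ltnW (ltnW (ltnW k_gt3)))).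
have M0 p : (mdeg p < m)%N -> tcoef v0 p (coef_mpoly 0 F) = 0.
  by move=> pm; rewrite -(tcoef_moving p F).1 mov // coef0.
have M1 p : (mdeg p < m)%N -> tcoef v0 p (coef_mpoly 1 F) =
    - ((p (1%R : 'I_3)).+1%:R * tcoef v0 (p + U_(1%R)) (coef_mpoly 0 F)).
  by move=> pm; apply/eqP; rewrite -addr_eq0 -(tcoef_moving p F).2 mov // coef0.
have uniq j : (forall p, (mdeg p < m - 1)%N -> tcoef v0 p (coef_mpoly j F) = 0) ->
    exists c, coef_mpoly j F = c *: lines K k ^+ m.
  move=> Hj; apply: (lines_unique k_gt3); first exact: coef_mpoly_homog.
  move=> l i lk ik; have := Fm l i lk ik; rewrite /moving_pt /mult_at.
  case: ifP => [/andP[/eqP -> /eqP ->] _|_ H].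
    by rewrite ptE; apply/multiplicity_geE.
  apply/multiplicity_geE => p pm; rewrite -tcoef_coef_mpoly.
  by move/multiplicity_geE: H => ->; rewrite ?coef0.
have [c0 E0] : exists c, coef_mpoly 0 F = c *: lines K k ^+ m.
  by apply: uniq => p pm; apply: M0; apply: leq_trans pm (leq_subr _ _).
have [c1 E1] : exists c, coef_mpoly 1 F = c *: lines K k ^+ m.
  apply: uniq => p pm; rewrite M1; last exact: leq_trans pm (leq_subr _ _).
  (* The correction to f_1 is a derivative of f_0 of order one higher, still below m. *)
  rewrite M0 ?mulr0 ?oppr0 // mdegD mdeg1; lia.
have lines_m : low_order m (translate v0 (lines K k ^+ m)).
  have [L1 _] := @lines_order K k 3 0 k_gt3; rewrite ptE in L1.
  rewrite rmorphXn; elim: (m) => [//|j IH]; rewrite exprS.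
  exact: (low_orderM L1 IH).
have c00 : c0 != 0.
  by apply: contra_neq Fg => c00; rewrite -coef_mpolyE E0 c00 scale0r mcoeff0.
(* The decisive index is m - 1 times U_1. On the left f_1 is a multiple of the m-th power of the
   lines, with zero coefficient there; on the right stands -m c0 times the coefficient at m U_1,
   which is u(0)^m by restriction to the axis. *)
have := M1 (U_(1%R) *+ (m - 1))%MM; rewrite mdegMn mdeg1 mul1n.
rewrite mulmnE mnm1E eqxx mul1n subn1 prednK // => /(_ (leqnn _)).
rewrite -mulmSr prednK // E0 E1 -!mcoeff_translate.
rewrite -![_ *: _ ^+ _]mul_mpolyC !rmorphM /= /translate !mmapC -/(translate _ _).
rewrite !mcoeffCM lines_m ?mulr0; last by rewrite mdegMn mdeg1 mul1n prednK.
move/esym/eqP; rewrite oppr_eq0 !mulf_eq0 pnatr_eq0 (negbTE c00) (gtn_eqF m_gt0) /=.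
rewrite -coef_axis.
have -> : mmap polyC (vec3 0 'X 0) (translate v0 (lines K k ^+ m)) =
    mmap polyC (vec3 1 'X 0) (lines K k) ^+ m.
  rewrite -rmorphXn /= /translate rmorph_mmap; apply: eq_mmap => [x|e] /=.
    by rewrite mmapC.
  rewrite rmorphD /= mmapX mmap1U mmapC.
  by elim/ord3_ind: e; rewrite /v0 !vec3E ?polyC0 ?polyC1 ?add0r ?addr0.
have [u [u0 ->]] := lines_axis.
rewrite exprMn coefXnM ltnn subnn -horner_coef0 horner_exp expf_eq0 (negbTE u0).
by rewrite andbF.
Qed.

End FirstOrder.

(** * Specialising generic points *)

Lemma multiplicity_geZ n (R : idomainType) m (v : 'I_n -> R) x F : x != 0 ->
  multiplicity_ge m v (x *: F) <-> multiplicity_ge m v F.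
Proof.
move=> x0; rewrite /multiplicity_ge -mul_mpolyC rmorphM /= {1}/translate mmapC.
split=> H p pm; last by rewrite mcoeffCM H // mulr0.
by apply: (mulfI x0); rewrite mulr0 -mcoeffCM H.
Qed.

Lemma homogZ n (R : idomainType) d x (F : {mpoly R[n]}) : x != 0 ->
  x *: F \is d.-homog -> F \is d.-homog.
Proof.
move=> x0 /dhomogP H; apply/dhomogP => g gF; apply: H.
by move: gF; rewrite !mcoeff_msupp mcoeffZ mulf_eq0 (negbTE x0).
Qed.

Lemma map_mpoly_homogP n (A B : comNzRingType) (u : {rmorphism A -> B}) d
    (F : {mpoly A[n]}) : injective u -> map_mpoly u F \is d.-homog ->
  F \is d.-homog.
Proof.
move=> u_inj /dhomogP H; apply/dhomogP => g gF; apply: H.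
move: gF; rewrite !mcoeff_msupp mcoeff_map_mpoly; apply: contra_neq => E.
by apply: u_inj; rewrite E raddf0.
Qed.

Lemma prim_root_exists (K : numClosedFieldType) n : (0 < n)%N ->
  exists z : K, n.-primitive_root z.
Proof.
move=> n0; pose p : {poly K} := 'X^n - 1.
have [rs] := closed_field_poly_normal p.
rewrite lead_coefDl ?lead_coefXn ?scale1r; last first.
  by rewrite size_polyN size_polyXn size_poly1 ltnS.
move=> Dp; have rn1 : all n.-unity_root rs.
  apply/allP => z zr; by rewrite /root_of_unity /= -/p Dp root_prod_XsubC.
have ur : uniq rs.
  rewrite -separable_prod_XsubC -Dp; apply: separable_Xn_sub_1.
  by rewrite pnatr_eq0 -lt0n.
have sr : (n <= size rs)%N.
  have := congr1 (fun q : {poly K} => size q) Dp.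
  by rewrite size_prod_XsubC size_XnsubC // => -[->].
by have /hasP[z _ zP] := has_prim_root n0 rn1 ur sr; exists z.
Qed.

Section Specialization.
Variables (K : numFieldType) (L : fieldType) (n : nat) (s t : 'I_n -> K).
Hypothesis generic : forall p : {mpoly rat[n + n]},
  mmap ratr (fun j => match split j with inl i => s i | inr i => t i end) p = 0 ->
  p = 0.

Lemma generic_specialization (s' t' : 'I_n -> L) d m (F : {mpoly K[3]}) :
  F != 0 -> F \is d.-homog ->
  (forall i, multiplicity_ge m (vec3 1 (s i) (t i)) F) ->
  exists F' : {mpoly L[3]}, [/\ F' != 0, F' \is d.-homog
    & forall i, multiplicity_ge m (vec3 1 (s' i) (t' i)) F'].
Proof.
move=> F0 Fd Fm.
pose coord T (u w : 'I_n -> T) (j : 'I_(n + n)) :=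
  match split j with inl i => u i | inr i => w i end.
pose phi := mmap (intmul (1 : K)) (coord K s t).
pose psi := mmap (intmul (1 : L)) (coord L s' t').
have phi_inj p : phi p = 0 -> p = 0.
  move=> p0; have : map_mpoly (intmul (1 : rat)) p = 0.
    apply: generic; rewrite -[RHS]p0 /map_mpoly rmorph_mmap.
    apply: eq_mmap => [x|j] /=; first by rewrite mmapC; exact: ratr_int.
    by rewrite mmapX mmap1U.
  move=> E; apply/mpolyP => g; apply: (@intr_inj rat).
  by rewrite -(mcoeff_map_mpoly (intmul (1 : rat))) E !mcoeff0.
pose V i := vec3 (1 : {mpoly int[n + n]}) 'X_(lshift n i) 'X_(rshift n i).
have VE (M : fieldType) (u w : 'I_n -> M) i :
    mmap (intmul (1 : M)) (coord M u w) \o V i = vec3 1 (u i) (w i).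
  apply/funext; elim/ord3_ind; rewrite /= /V !vec3E ?rmorph1 // mmapX mmap1U.
    by rewrite /coord (unsplitK (inl i)).
  by rewrite /coord (unsplitK (inr i)).
have FmV i : multiplicity_ge m (phi \o V i) F by rewrite VE.
have [F' [F'0 F'd F'm]] := multiplicity_specialization psi phi_inj F0 Fd FmV.
by exists F'; split=> // i; rewrite -VE.
Qed.

End Specialization.

Section SquareForm.
Local Notation A := ({poly rat} : idomainType).
Local Notation tf := (@FracField.tofrac {poly rat}).

(* The generic points specialise to those of the line arrangement over Q(t). *)
Lemma no_square_form (K : numFieldType) k m (s t : 'I_(k * k) -> K)
    (F : {mpoly K[3]}) :
  (forall p : {mpoly rat[k * k + k * k]},
    mmap ratr (fun j => match split j with inl i => s i | inr i => t i end) p = 0 ->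
    p = 0) ->
  (3 < k)%N -> (0 < m)%N -> F != 0 -> F \is (k * m).-homog ->
  ~ (forall i, multiplicity_ge m (vec3 1 (s i) (t i)) F).
Proof.
move=> generic k3 m0 F0 Fd Fm.
have k0 : (0 < k)%N by exact: leq_trans k3.
pose mp (i : 'I_(k * k)) : 'I_3 -> A := @moving_pt rat (i %/ k)%N (i %% k)%N.
have mp0 i : mp i 0 = 1 by rewrite /mp /moving_pt; case: ifP.
have [F' [F'0 F'd F'm]] := generic_specialization generic
  (fun i => tf (mp i 1)) (fun i => tf (mp i 2)) F0 Fd Fm.
have vE i : vec3 1 (tf (mp i 1)) (tf (mp i 2)) = tf \o mp i.
  by apply/funext; elim/ord3_ind; rewrite vec3E /= ?mp0 ?rmorph1.
have [a [G [a0 GE]]] := clear_denominators F'.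
have ta0 : tf a != 0 by rewrite tofrac_eq0.
have tf_inj : injective tf by move=> x y /eqP; rewrite tofrac_eq => /eqP.
have G0 : G != 0.
  apply: contra_neq F'0 => G0; apply/eqP; move/eqP: GE.
  by rewrite G0 rmorph0 eq_sym mscalerI (negbTE ta0).
have Gd : G \is (k * m).-homog.
  by apply: (map_mpoly_homogP tf_inj); rewrite GE; exact: dhomogZ.
have Gm i : multiplicity_ge m (mp i) G.
  apply/multiplicity_geE => p pm; apply: tf_inj; rewrite rmorph0 map_tcoef GE.
  move: p pm; apply/multiplicity_geE; apply/(multiplicity_geZ _ _ _ ta0).
  by rewrite -vE; exact: F'm.
have [j [H [GH [g Hg]]]] := primitive_representative G0.
have Xj0 : ('X^j : A) != 0 by rewrite expf_neq0 // polyX_eq0.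
have Hd : H \is (k * m).-homog by apply: (homogZ Xj0); rewrite -GH.
apply: (first_order_obstruction k3 m0 Hd Hg) => l i lk ik.
have li : (l * k + i < k * k)%N.
  apply: (@leq_trans (l.+1 * k)%N); last by rewrite leq_mul2r lk orbT.
  by rewrite mulSn addnC ltn_add2r.
apply/(multiplicity_geZ _ _ _ Xj0); rewrite -GH.
suff <- : mp (Ordinal li) = @moving_pt rat l i by [].
have e1 : ((l * k + i) %/ k)%N = l by rewrite divnMDl // divn_small // addn0.
have e2 : ((l * k + i) %% k)%N = i by rewrite modnMDl modn_small.
have -> : mp (Ordinal li) =
  @moving_pt rat ((l * k + i) %/ k)%N ((l * k + i) %% k)%N by [].
by rewrite e1 e2.
Qed.

End SquareForm.

Lemma scale_multiplicity n (R : idomainType) m d (v : 'I_n -> R) q F :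
  F \is d.-homog -> multiplicity_ge m v F ->
  multiplicity_ge m (fun e => v e * q) F.
Proof.
move=> Fd /multiplicity_geE Fm; apply/multiplicity_geE => p pm.
have := tcoef_scale v q p Fd; rewrite Fm // mul0r => E.
by rewrite -[RHS]E; congr (tcoef _ _ _); apply/funext => e; rewrite /= mdeg1 expr1.
Qed.

(* Specialising the points to the preimages of the v q under
   (x : y : z) -> (x^a : y^b : z^c). *)
Lemma weighted_form (K : numClosedFieldType) a b c r d m
    (s t : 'I_(a * b * c * r) -> K) (F : {mpoly K[3]}) (v : 'I_r -> 'I_3 -> K) :
  (0 < a)%N -> (0 < b)%N -> (0 < c)%N ->
  (forall p : {mpoly rat[a * b * c * r + a * b * c * r]},
    mmap ratr (fun j => match split j with inl i => s i | inr i => t i end) p = 0 ->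
    p = 0) ->
  (forall q e, v q e != 0) -> F != 0 -> F \is d.-homog ->
  (forall i, multiplicity_ge m (vec3 1 (s i) (t i)) F) ->
  exists (G : {mpoly K[3]}) (e : nat), [/\ G != 0, (e <= d)%N,
    G \is e.-homog for (wdeg a b c) & forall q, multiplicity_ge m (v q) G].
Proof.
move=> a0 b0 c0 generic v0 F0 Fd Fm.
pose w e := weight a b c e.
have w0 e : (0 < w e)%N by exact: weight_gt0.
have [zeta zetaP] := choice (fun e => prim_root_exists K (w0 e)).
pose nu q e : K := (w e).-root (v q e).
have nuE q e : nu q e ^+ w e = v q e by exact: rootCK.
have nu0 q e : nu q e != 0.
  by apply: contra_neq (v0 q e) => E; rewrite -nuE E expr0n gtn_eqF.
pose T : finType := ('I_a * 'I_b * 'I_c * 'I_r)%type.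
have cT : (a * b * c * r = #|{: T}|)%N by rewrite !card_prod !card_ord.
pose pre (x : T) : 'I_3 -> K := fun e => nu x.2 e * zeta e ^+
  vec3 (x.1.1.1 : nat) (x.1.1.2 : nat) (x.1.2 : nat) e.
have pre0 x e : pre x e != 0.
  rewrite mulf_neq0 // expf_neq0 //; apply/eqP => z0.
  have := prim_expr_order (zetaP e); rewrite z0 expr0n gtn_eqF // => /eqP.
  by rewrite eq_sym oner_eq0.
pose P i := pre (enum_val (cast_ord cT i)).
(* Generic points have first coordinate 1, so the preimages are normalised; homogeneity of F' then
   restores their original scale. *)
have [F' [F'0 F'd F'm]] := generic_specialization generic
  (fun i => P i 1 / P i 0) (fun i => P i 2 / P i 0) F0 Fd Fm.
have F'P x : multiplicity_ge m (pre x) F'.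
  have := F'm (cast_ord (esym cT) (enum_rank x)).
  move=> /(scale_multiplicity (P (cast_ord (esym cT) (enum_rank x)) 0) F'd).
  rewrite /P cast_ordKV enum_rankK.
  suff -> : (fun e => vec3 1 (pre x 1 / pre x 0) (pre x 2 / pre x 0) e * pre x 0)
    = pre x by [].
  by apply/funext; elim/ord3_ind; rewrite vec3E ?mul1r ?divfK.
have F'j q (j : 'I_3 -> nat) : multiplicity_ge m (fun e => nu q e * zeta e ^+ j e) F'.
  pose x : T := (Ordinal (ltn_pmod (j 0) a0), Ordinal (ltn_pmod (j 1) b0),
    Ordinal (ltn_pmod (j 2) c0), q).
  suff <- : pre x = (fun e => nu q e * zeta e ^+ j e) by exact: F'P.
  apply/funext => e; rewrite /pre /=; congr (_ * _).
  rewrite -(prim_expr_mod (zetaP e) (j e)); congr (_ ^+ _).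
  by rewrite /w weightE; elim/ord3_ind: e.
have [g gF'] : exists g, F'@_g != 0 by exists (mlead F'); rewrite mleadc_eq0.
(* The class of a monomial occurring in F', so that its isotypic component is nonzero. *)
pose rho : 'X_{1..3} := [multinom (g e %% w e)%N | e < 3].
have rho_lt e : (rho e < w e)%N by rewrite mnmE ltn_mod.
exists (descent (wdeg a b c) F' rho), (d - mdeg rho)%N.
have desc q := @descent_multiplicity K 3 (wdeg a b c) zeta (nu q) w0 zetaP (nu0 q)
  m F' (F'j q) rho rho_lt.
split.
- apply: contra_neq gF' => D0.
  have := isotypic_coef (wdeg a b c) F' rho g.
  rewrite (isotypicE F' rho_lt) D0 rmorph0 mulr0 mcoeff0.
  rewrite ifT //; apply/forallP => e.
  by rewrite mnmE modn_mod.
- exact: leq_subr.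
- exact: (descent_homog rho_lt F'd).
by move=> q; have := desc q; rewrite (_ : (fun _ => _) = v q) //; apply/funext.
Qed.

Theorem proposition5p2 (R : realType) (n a b c r : nat)
    (n_ge10 : (10 <= n)%N)
    (a_gt0 : (0 < a)%N) (b_gt0 : (0 < b)%N) (c_gt0 : (0 < c)%N)
    (r_gt0 : (0 < r)%N) (n_def : n = (a * b * c * r)%N)
    (co_ab : coprime a b) (co_ac : coprime a c) (co_bc : coprime b c)
    (no_negative_curve :
      exists P : 'I_r -> proj R a b c,
        [/\ injective P,
            forall i, closed_point (P i),
            forall i, ~ proj_ideal (P i) ('X_0 * 'X_1 * 'X_2)
          & exists A : weil_divisor R a b c r, pullback_O1 P A /\
              ~ exists D : weil_divisor R a b c r,
                  E_uniform_negative_curve P A D])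
    (s t : 'I_n -> R[i]) (generic : independent_generic s t)
    (d m : nat) (d_gt0 : (0 < d)%N) (m_gt0 : (0 < m)%N)
    (d_le : d%:R <= Num.sqrt (n%:R : R) * m%:R)
    (f : {mpoly R[i][3]}) :
  f \is d.-homog ->
  (forall i : 'I_n,
     ideal_pow (point_ideal (tnth [tuple 1; s i; t i])) m f) ->
  f = 0.
Proof.
move=> fd fI; apply: contrapT => /eqP f0.
have fm i : multiplicity_ge m (vec3 1 (s i) (t i)) f.
  apply: ideal_pow_multiplicity (fI i) => g gI.
  rewrite (pihomog_partitionE (leqnn (mmeasure mdeg g))) rmorph_sum /=.
  by apply: big1 => k _; exact: gI.
have dm : (d ^ 2 <= n * m ^ 2)%N.
  have : (d%:R : R) ^+ 2 <= (Num.sqrt (n%:R : R) * m%:R) ^+ 2.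
    by rewrite lerXn2r ?nnegrE ?mulr_ge0 ?sqrtr_ge0 ?ler0n.
  by rewrite exprMn sqr_sqrtr ?ler0n // -!natrX -natrM ler_nat.
move: dm; rewrite leq_eqVlt => /orP[/eqP dm|dm].
  (* From d^2 = n m^2 it follows that m^2 divides d^2, hence m divides d and n is a square. *)
  have /dvdnP[k dk] : (m %| d)%N by rewrite -(dvdn_pexp2r m d (ltn0Sn 1)) dm dvdn_mull.
  have nk : n = (k * k)%N.
    apply/eqP; rewrite -(eqn_pmul2r (m := m ^ 2)) ?expn_gt0 ?m_gt0 // -dm dk.
    by rewrite expnMn mulnn.
  clear n_def; subst n d; have k3 : (3 < k)%N.
    by rewrite ltnNge; apply/negP => k3; move: n_ge10; nia.
  exact: (@no_square_form R[i] k m s t f generic k3 m_gt0 f0 fd fm).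
have [P [_ Pcl Pxyz [A [PA noD]]]] := no_negative_curve; apply: noD.
have [v vP] := choice (fun i => closed_point_vector a_gt0 b_gt0 c_gt0 (Pcl i) (Pxyz i)).
have v0 i e : v i e != 0 by exact: (vP i).1.
have PE i : proj_ideal (P i) = orbit_ideal a b c (v i) by exact: (vP i).2.
subst n; have [G [e [G0 ed Ge Gm]]] :=
  weighted_form a_gt0 b_gt0 c_gt0 generic v0 f0 fd fm.
apply: (negative_curve_of_form a_gt0 b_gt0 c_gt0 co_ab v0 PE PA G0 Ge _ m_gt0 Gm).
  (* A form of degree 0 is constant, and a constant with a zero of order m > 0 is 0. *)
  rewrite lt0n; apply: contra_neqN G0 => /eqP e0; rewrite e0 in Ge.
  have := Gm (Ordinal r_gt0) 0%MM; rewrite mdeg0 => /(_ m_gt0).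
  rewrite translate0 [G](homog0_const (weight_gt0 a_gt0 b_gt0 c_gt0) Ge) mevalC.
  by move=> ->.
by apply: leq_ltn_trans dm; rewrite leq_exp2r.
Qed.
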